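(* Let $n\ge2$, $B_1$ the open unit ball of $\mathbb R^n$, and $\alpha\in\mathbb R$ with $|3\alpha+4+n|\le2\sqrt{n^2-n+1}$. Then for every $u\in C_c^2(B_1\setminus\{0\})$, $$\|\Delta u\|_\alpha^2\ \ge\ \frac{(n+\alpha)^2}{4}\|\nabla u\|_{\alpha+2}^2+\frac{(n-4-\alpha)^2}{16}\big\|(\ln|x|)^{-1}u\big\|_{\alpha+4}^2+\frac9{16}\big\|(\ln|x|)^{-2}u\big\|_{\alpha+4}^2 .$$
   Context: For $\beta\in\mathbb R$ and $g$ (scalar or vector valued) continuous with compact support in $\mathbb R^n\setminus\{0\}$, $\|g\|_\beta^2=\int_{\mathbb R^n}|g(x)|^2|x|^{-\beta}\,dx$. *)

(* Defs.v *)
From HB Require Import structures.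
From mathcomp Require Import all_boot all_order all_algebra.
From mathcomp Require Import all_classical all_reals all_analysis.
Set Implicit Arguments. Unset Strict Implicit. Unset Printing Implicit Defensive.
Import Order.TTheory GRing.Theory Num.Theory.
Import numFieldNormedType.Exports.
Local Open Scope classical_set_scope.
Local Open Scope ring_scope.

Section Defs.
Variables (R : realType) (n : nat).
Notation V := 'rV[R]_n.

(* Euclidean norm |x| on R^n (the library norm on 'rV is the sup norm). *)
Definition enorm (x : V) : R := Num.sqrt (\sum_(i < n) x 0 i ^+ 2).

Definition ebasis (i : 'I_n) : V := delta_mx 0 i.

Definition partial (i : 'I_n) (f : V -> R) : V -> R := fun x => 'D_(ebasis i) f x.

Definition C2 (u : V -> R) : Prop :=
  continuous u /\
  (forall i x, derivable u x (ebasis i)) /\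
  (forall i, continuous (partial i u)) /\
  (forall i j x, derivable (partial i u) x (ebasis j)) /\
  (forall i j, continuous (partial j (partial i u))).

Definition support_set (u : V -> R) : set V := closure [set x | u x != 0].

Definition punctured_ball : set V := [set x | enorm x < 1 /\ x != 0].

Definition Cc2_punctured_ball (u : V -> R) : Prop :=
  C2 u /\ compact (support_set u) /\ support_set u `<=` punctured_ball.

(* Lebesgue integral over R^n as iterated one-dimensional Lebesgue integrals
   (integrate coordinates k-1, ..., 0 of x); by Fubini this is the Lebesgue
   integral over R^n for the continuous compactly supported integrands used here. *)
Fixpoint iter_integral (k : nat) (f : V -> R) (x : V) : R :=
  match k with
  | 0 => f x
  | k'.+1 => Rintegral (@lebesgue_measure R) setT
      (fun t : R => iter_integral k' f (\row_j (if nat_of_ord j == k' then t else x 0 j)))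
  end.

Definition integralRn (f : V -> R) : R := iter_integral n f 0.

Definition wnorm2 (beta : R) (g : V -> R) : R :=
  integralRn (fun x => `|g x| ^+ 2 * (enorm x `^ (- beta))).

Definition laplacian (u : V -> R) : V -> R := fun x => \sum_(i < n) partial i (partial i u) x.
Definition grad_norm2 (u : V -> R) : V -> R := fun x => \sum_(i < n) (partial i u x) ^+ 2.

Definition wnorm2_grad (beta : R) (u : V -> R) : R :=
  integralRn (fun x => grad_norm2 u x * (enorm x `^ (- beta))).

End Defs.

(* Main.v *)
Require Import Defs.
From mathcomp Require Import all_boot all_order all_algebra.
From mathcomp Require Import all_classical all_reals all_analysis.
From mathcomp Require Import ring lra.
Set Implicit Arguments. Unset Strict Implicit. Unset Printing Implicit Defensive.
Import Order.TTheory GRing.Theory Num.Theory.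
Import numFieldNormedType.Exports.
Local Open Scope classical_set_scope.
Local Open Scope ring_scope.

(** Write [E = x . grad], [L_ij = x_i d_j - x_j d_i], [Lambda = 1/2 sum_ij L_ij^2],
    [t = ln |x|], [mu = |x|^-n dx], and substitute [u = |x|^-c w] with
    [c = (n - 4 - alpha) / 2], [d = (n + alpha) / 2].  All the fields [E] and [L_ij]
    are skew for [mu], and integrating by parts turns
    [||Delta u||^2 - d^2 ||grad u||^2] into the [mu]-integral of
<<
    (E^2 w)^2 + c^2 (E w)^2 + (Lambda w)^2 + sum_ij (L_ij E w)^2 + (2 c d - d^2) |L w|^2,
>>
    where [|L w|^2 = 1/2 sum_ij (L_ij w)^2].  The first two terms are bounded below by the
    one-dimensional Hardy and Rellich inequalities in [t < 0].  The others are nonnegative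
    because [mu (Lambda w)^2 >= (n - 1) mu |L w|^2], the hypothesis on [alpha] being
    exactly [n - 1 + 2 c d - d^2 >= 0].

    The last inequality is proved without spherical harmonics.  A function [v] vanishing on
    the hyperplane [x_k = 0] satisfies [mu |L v|^2 >= (n - 1) mu v^2], the coordinate [x_k]
    being a ground state.  Splitting [w] by the reflections [x_k -> - x_k], either [w] is odd
    in some [x_k] and Cauchy-Schwarz applies, or [w] is even in every [x_k], in which case
    each [L_ij w] vanishes on [x_i = 0] and one uses that [L_ij] commutes with [Lambda].

    Since [u] is only C^2, identities that formally involve third derivatives come from
    [int d_i p d_j v = int d_j p d_i v], valid for C^1 functions by translation invariance
    and difference quotients; the iterated integral enters only as a positive linear
    functional invariant under translations and reflections. *)

(** * Iterated integrals of compactly supported functions *)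

Section OneDimensional.
Variable R : realType.
Local Notation leb := (@lebesgue_measure R).
Implicit Types (g : R -> R) (M c : R).

Lemma Rintegral_supp g a b : (forall t, t \notin `[a, b] -> g t = 0) ->
  Rintegral leb setT g = Rintegral leb `[a, b] g.
Proof.
move=> g0; rewrite [RHS]Rintegral_mkcond; apply: eq_Rintegral => t _.
rewrite patchE; case: ifPn => // tab; apply: g0.
by apply: contra tab => tab; rewrite inE.
Qed.

Lemma integrable_supp g M : continuous g -> (forall t, M < `|t| -> g t = 0) ->
  leb.-integrable setT (EFin \o g).
Proof.
move=> cg g0.
have -> : EFin \o g = (EFin \o g) \_ `[- M, M].
  apply/funext => t; rewrite patchE; case: ifPn => // tab /=; rewrite g0//.
  rewrite ltNge; apply: contra tab => tM; rewrite inE/= in_itv/=.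
  by rewrite -ler_norml.
rewrite -integrable_mkcond//; apply: continuous_compact_integrable.
  exact: segment_compact.
exact: continuous_subspaceT.
Qed.

Lemma normr_Rintegral_supp g M c : 0 <= M -> 0 <= c -> continuous g ->
  (forall t, M < `|t| -> g t = 0) -> (forall t, `|g t| <= c) ->
  `|Rintegral leb setT g| <= c * (2 * M).
Proof.
move=> M0 c0 cg g0 gc.
have gi := integrable_supp cg g0.
have g0' t : t \notin `[- M, M] -> g t = 0.
  by rewrite in_itv/= => tM; rewrite g0// ltNge; apply: contra tM; rewrite ler_norml.
rewrite (Rintegral_supp g0').
have gi' : leb.-integrable `[- M, M] (EFin \o g) by apply: integrableS gi.
apply: le_trans (le_normr_Rintegral _ gi') _ => //.
have -> : c * (2 * M) = Rintegral leb `[- M, M] (fun=> c).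
  rewrite Rintegral_cst//; have := @lebesgue_measure_itv R `[- M, M].
  rewrite /= => ->; rewrite lte_fin.
  have [->|Mn] := eqVneq M 0; first by rewrite oppr0 ltxx/= !mulr0.
  have Mp : 0 < M by rewrite lt0r Mn.
  have MM : - M < M by lra.
  rewrite ifT; last exact: MM.
  by rewrite /= opprK (_ : M + M = 2 * M)//; ring.
apply: (@le_Rintegral _ _ _ leb) => //.
- apply: (integrable_norm gi').
- apply: continuous_compact_integrable; first exact: segment_compact.
  by apply: continuous_subspaceT; exact: cst_continuous.
Qed.

Lemma Rintegral_shift g M h : 0 <= M -> continuous g ->
  (forall t, M < `|t| -> g t = 0) ->
  Rintegral leb setT (fun t => g (t + h)) = Rintegral leb setT g.
Proof.
move=> M0 cg g0.
(* The margin [|h|] makes both [[- N, N]] and its translate by [h] long enough: the first contains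
   the support of [g (t + h)], the second that of [g]. The substitution then takes place on a
   segment. *)
pose N := M + `|h|.
have Nh : `|h| <= N by rewrite lerDr.
have N0 : 0 <= N by rewrite (le_trans _ Nh).
rewrite (@Rintegral_supp g (- N + h) (N + h)); last first.
  move=> t tN; apply: g0; rewrite ltNge; apply: contra tN => tM.
  rewrite in_itv/=; apply/andP; split; move: tM; rewrite ler_norml => /andP[t1 t2];
    have := ler_norm h; have := ler_norm (- h); rewrite normrN /N; lra.
rewrite (@Rintegral_supp (fun t => g (t + h)) (- N) N); last first.
  move=> t tN; apply: g0; rewrite ltNge; apply: contra tN => tM.
  rewrite in_itv/=; apply/andP; split; move: tM; rewrite ler_norml => /andP[t1 t2];
    have := ler_norm h; have := ler_norm (- h); rewrite normrN /N; lra.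
rewrite /Rintegral; congr fine; apply/esym.
have D : derive1 (fun t : R => t + h) = cst 1.
  apply/funext => t; rewrite derive1E.
  exact: (@derive_val _ _ _ _ _ _ _ (is_derive_shift t 1 h)).
have cF : continuous (fun t : R => t + h).
  by move=> t; apply: cvgD; [exact: cvg_id|exact: cvg_cst].
rewrite (@integration_by_substitution_increasing _ (fun t => t + h)).
- by apply: eq_integral => t _ /=; rewrite D/= !fctE mulr1.
- lra.
- by move=> x y _ _; rewrite ltrD2r.
- by rewrite D => t _; exact: cst_continuous.
- by rewrite D; exact: is_cvg_cst.
- by rewrite D; exact: is_cvg_cst.
- split.
  + by move=> t _; apply: (@ex_derive _ _ _ _ _ _ _ (is_derive_shift t 1 h)).
  + by apply: cvg_at_right_filter; exact: cF.
  + by apply: cvg_at_left_filter; exact: cF.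
- exact: continuous_subspaceT.
Qed.

Lemma Rintegral_reflect g M : 0 <= M -> continuous g ->
  (forall t, M < `|t| -> g t = 0) ->
  Rintegral leb setT (fun t => g (- t)) = Rintegral leb setT g.
Proof.
move=> M0 cg g0.
(* Writing the upper end as [- - M] gives the segment the form [[- b, - a]] expected by the
   substitution [t |-> - t] on [[a, b]]. *)
rewrite (@Rintegral_supp g (- M) (- - M)); last first.
  move=> t tN; apply: g0; rewrite ltNge; apply: contra tN => tM.
  by rewrite in_itv/= opprK -ler_norml.
rewrite (@Rintegral_supp (fun t => g (- t)) (- M) M); last first.
  move=> t tN; apply: g0; rewrite ltNge; apply: contra tN => tM.
  by rewrite in_itv/= -ler_norml -normrN.
rewrite /Rintegral; congr fine; apply/esym.
rewrite integration_by_substitution_oppr//; first lra.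
exact: continuous_subspaceT.
Qed.

End OneDimensional.

(** * Linearity, bounds and coordinate symmetries of the iterated integral *)

Section IteratedIntegral.
Variables (R : realType) (n : nat).
Local Notation V := 'rV[R]_n.
Local Notation leb := (@lebesgue_measure R).
Implicit Types (f g : V -> R) (x y : V) (M c : R).

(** Uniform continuity in the sup norm is what survives the integration of one coordinate: a modulus
    for the integrand, times the length of the support, is a modulus for the integral. *)
Definition unifc f := forall e, 0 < e -> exists2 d, 0 < d &
  forall x y, (forall i, `|x 0 i - y 0 i| < d) -> `|f x - f y| <= e.

(* [k] is the number of coordinates already integrated out: only the other
   ones still carry a support condition. *)
Definition box_supp k M f := forall x (i : 'I_n), (k <= i)%N -> M < `|x 0 i| -> f x = 0.

(** The index is a natural number and the body copies the one inside [iter_integral], so that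
    [iter_integralS] holds by conversion. *)
Definition upd x (k : nat) (t : R) : V := \row_j (if nat_of_ord j == k then t else x 0 j).

Lemma unifc_upd f x k : unifc f -> continuous (fun t => f (upd x k t)).
Proof.
move=> uf t; apply/cvgrPdist_le => e e0; have [d d0 H] := uf e e0.
near=> s; apply: H => i; rewrite !mxE; case: ifP => _; last by rewrite subrr normr0.
by near: s; apply: cvgr_dist_lt => //; exact: cvg_id.
Unshelve. all: by end_near. Qed.

Lemma iter_integralS k f x : iter_integral k.+1 f x =
  Rintegral leb setT (fun t => iter_integral k f (upd x k t)).
Proof. by []. Qed.

Section step.
Variables (M : R) (k : nat) (F : V -> R).
Hypotheses (M0 : 0 <= M) (kn : (k < n)%N) (uF : unifc F) (sF : box_supp k M F).

Lemma slice_supp x t : M < `|t| -> F (upd x k t) = 0.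
Proof. by move=> Mt; apply: (sF (i := Ordinal kn)) => //; rewrite mxE/= eqxx. Qed.

Lemma slice_integrable x : leb.-integrable setT (EFin \o (fun t => F (upd x k t))).
Proof. apply: (@integrable_supp R _ M); [exact: unifc_upd|exact: slice_supp]. Qed.

Lemma slice_unifc : unifc (fun x => Rintegral leb setT (fun t => F (upd x k t))).
Proof.
(* The support has length [2 * M]; the added 1 keeps the divisor positive when [M = 0]. *)
move=> e e0; have M1 : 0 < 2 * M + 1 by rewrite ltr_wpDl// mulr_ge0.
have [d d0 H] := uF (divr_gt0 e0 M1).
exists d => // x y xy.
rewrite -RintegralB//; [|exact: slice_integrable..].
apply: (@le_trans _ _ (e / (2 * M + 1) * (2 * M))); last first.
  by rewrite mulrAC ler_pdivrMr// ler_wpM2l ?lerDl// ltW.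
apply: normr_Rintegral_supp => //.
- by rewrite divr_ge0// ltW.
- by move=> t; apply: cvgB; exact: unifc_upd.
- by move=> t Mt; rewrite !slice_supp// subrr.
- move=> t; apply: H => i; rewrite !mxE; case: ifP => _ //.
  by rewrite subrr normr0.
Qed.

Lemma slice_box_supp : box_supp k.+1 M (fun x => Rintegral leb setT (fun t => F (upd x k t))).
Proof.
move=> x i ki xi; rewrite (_ : (fun t => _) = cst 0); last first.
  apply/funext => t/=; apply: (sF (i := i)); first exact: ltnW.
  by rewrite mxE; case: eqP ki => // ->; rewrite ltnn.
by rewrite Rintegral_cst// mul0r.
Qed.

End step.

(** The two properties are the joint invariant of the induction on [k]: together they make every
    one-dimensional slice continuous with compact support, hence integrable. *)
Lemma iter_integral_class M f k : 0 <= M -> unifc f -> box_supp 0 M f -> (k <= n)%N ->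
  unifc (iter_integral k f) /\ box_supp k M (iter_integral k f).
Proof.
move=> M0 uf sf; elim: k => // k IH kn; have [u s] := IH (ltnW kn).
by split; [exact: (slice_unifc M0 kn u s)|exact: (slice_box_supp (k := k))].
Qed.

Lemma iter_integral_lin M f g a b k x : 0 <= M -> unifc f -> box_supp 0 M f ->
  unifc g -> box_supp 0 M g -> (k <= n)%N ->
  iter_integral k (fun x => a * f x + b * g x) x =
  a * iter_integral k f x + b * iter_integral k g x.
Proof.
move=> M0 uf sf ug sg; elim: k x => // k IH x kn.
have [u s] := iter_integral_class M0 uf sf (ltnW kn).
have [u' s'] := iter_integral_class M0 ug sg (ltnW kn).
have i1 := slice_integrable kn u s x; have i2 := slice_integrable kn u' s' x.
rewrite !iter_integralS -!RintegralZl// -RintegralD//.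
- by apply: eq_Rintegral => t _; rewrite IH// ltnW.
- by have := integrableZl (measurableT) a i1; under eq_fun do rewrite -EFinM.
- by have := integrableZl (measurableT) b i2; under eq_fun do rewrite -EFinM.
Qed.

Lemma iter_integral_ge0 f k x : (forall x, 0 <= f x) -> 0 <= iter_integral k f x.
Proof.
move=> f0; elim: k x => [|k IH] x; first exact: f0.
by apply: Rintegral_ge0 => t _; exact: IH.
Qed.

Lemma iter_integral_bound M f c k x : 0 <= M -> 0 <= c -> unifc f -> box_supp 0 M f ->
  (forall x, `|f x| <= c) -> (k <= n)%N -> `|iter_integral k f x| <= c * (2 * M) ^+ k.
Proof.
move=> M0 c0 uf sf fc; elim: k x => [|k IH] x kn; first by rewrite expr0 mulr1.
have [u s] := iter_integral_class M0 uf sf (ltnW kn).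
rewrite exprSr mulrA; apply: normr_Rintegral_supp => //.
- by rewrite mulr_ge0// exprn_ge0// mulr_ge0.
- exact: unifc_upd.
- by move=> t; exact: slice_supp kn s x t.
- by move=> t; apply: IH; exact: ltnW.
Qed.

Lemma eq_iter_integral f g k x : f =1 g -> iter_integral k f x = iter_integral k g x.
Proof. by move=> /funext ->. Qed.

Definition coordmap (i : 'I_n) (a : R -> R) x := upd x i (a (x 0 i)).

(** Until coordinate [i] is integrated, the change of variable just acts on the base point
    ([below]); the integral in that coordinate absorbs it by the one-dimensional invariance, and no
    trace of it remains later ([above]). Translations and reflections are the two instances. *)
Lemma iter_integral_coordmap M f (i : 'I_n) (a : R -> R) : 0 <= M ->
  unifc f -> box_supp 0 M f ->
  (forall g : R -> R, continuous g -> (forall t, M < `|t| -> g t = 0) ->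
    Rintegral leb setT (fun t => g (a t)) = Rintegral leb setT g) ->
  integralRn (f \o coordmap i a) = integralRn f.
Proof.
move=> M0 uf sf Ha.
have below k x : (k <= i)%N ->
    iter_integral k (f \o coordmap i a) x = iter_integral k f (coordmap i a x).
  elim: k x => // k IH x ki; rewrite !iter_integralS.
  apply: eq_Rintegral => t _; rewrite IH 1?ltnW//; congr (iter_integral k f _).
  apply/rowP => j; rewrite !mxE (gtn_eqF ki).
  by have [->|] := eqVneq (nat_of_ord j) i; rewrite ?(gtn_eqF ki).
have above k x : (i < k)%N -> (k <= n)%N ->
    iter_integral k (f \o coordmap i a) x = iter_integral k f x.
  elim: k x => // k IH x; rewrite ltnS leq_eqVlt => /predU1P[ik|ik] kn; last first.
    by rewrite !iter_integralS; apply: eq_Rintegral => t _; rewrite IH// ltnW.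
  rewrite !iter_integralS -ik.
  have [u s] := iter_integral_class M0 uf sf (ltnW (ltn_ord i)).
  rewrite -(Ha (fun t => iter_integral i f (upd x i t))).
  - apply: eq_Rintegral => t _; rewrite below//; congr (iter_integral i f _).
    by apply/rowP => j; rewrite !mxE eqxx; case: eqP.
  - exact: unifc_upd.
  - by move=> t; exact: (slice_supp (ltn_ord i) s).
exact: above.
Qed.

End IteratedIntegral.

(** * Test functions and multipliers *)

Section DirectionalDerivative.
Variables (R : realType) (n : nat).
Local Notation V := 'rV[R]_n.
Implicit Types (f g : V -> R) (x v : V).

Lemma is_derive_line f x v (t df : R) :
  is_derive (t *: v + x) v f df -> is_derive t 1 (fun s => f (s *: v + x)) df.
Proof.
move=> fd.
suff : is_derive t 1 (fun s => f ((s - t) *: v + (t *: v + x))) df.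
  by under eq_fun do rewrite addrA -scalerDl subrK.
have E : (fun h : R => h^-1 *: (((fun s => f ((s - t) *: v + (t *: v + x))) \o shift t)
    (h *: 1) - f ((t - t) *: v + (t *: v + x)))) =
    (fun h : R => h^-1 *: ((f \o shift (t *: v + x)) (h *: v) - f (t *: v + x))).
  by apply/funext => h /=; rewrite [h *: 1]mulr1 addrK subrr scale0r add0r.
split; first by rewrite /derivable E; exact: ex_derive.
by rewrite /derive E; exact: derive_val.
Qed.

Lemma line_is_derive f x v (df : R) :
  is_derive (0 : R) 1 (fun s : R => f (s *: v + x)) df -> is_derive x v f df.
Proof.
move=> fd.
have E : (fun h : R => h^-1 *: ((f \o shift x) (h *: v) - f x)) =
    (fun h : R => h^-1 *: (((fun s => f (s *: v + x)) \o shift 0) (h *: 1) -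
      f (0 *: v + x))).
  by apply/funext => h /=; rewrite [h *: 1]mulr1 addr0 scale0r add0r.
split; first by rewrite /derivable E; exact: ex_derive.
by rewrite /derive E; exact: derive_val.
Qed.

(** Restricting to the line through [x] reduces this to the chain rule in one variable, so a
    derivative of [f] along [v] is enough. *)
Lemma is_derive_comp1 (h : R -> R) f x v a b :
  is_derive x v f b -> is_derive (f x) 1 h a -> is_derive x v (h \o f) (a * b).
Proof.
move=> fd hd; apply: line_is_derive.
apply: (@is_derive1_comp _ h (fun s => f (s *: v + x))).
  by rewrite scale0r add0r.
by apply: is_derive_line; rewrite scale0r add0r.
Qed.

Lemma MVT_line f v x (h : R) : (forall x, derivable f x v) ->
  exists2 c, `|c| <= `|h| & f (h *: v + x) - f x = h * 'D_v f (c *: v + x).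
Proof.
move=> fd; pose phi s := f (s *: v + x).
have dphi (s : R) : is_derive s 1 phi ('D_v f (s *: v + x)).
  by apply: is_derive_line; apply: derivableP.
have cphi : continuous phi.
  move=> s; apply/differentiable_continuous/derivable1_diffP.
  exact: (@ex_derive _ _ _ _ _ _ _ (dphi s)).
have [h0|h0] := leP 0 h.
- have [c] := MVT_segment h0 (fun s _ => dphi s) (continuous_subspaceT cphi).
  rewrite in_itv/= => /andP[c0 ch] E; exists c; first by rewrite !ger0_norm.
  by move: E; rewrite /phi scale0r add0r subr0 mulrC.
- have [c] := MVT_segment (ltW h0) (fun s _ => dphi s) (continuous_subspaceT cphi).
  rewrite in_itv/= => /andP[c0 ch] E; exists c.
    by rewrite !ler0_norm ?lerN2// ltW.
  by move/(congr1 -%R): E; rewrite opprB /phi scale0r add0r sub0r mulrN opprK mulrC.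
Qed.

End DirectionalDerivative.

(** Inner and outer radius of a closed annulus inside the punctured unit ball, in which the support
    of a test function is confined. *)
Record radii (R : realType) := Radii {
  rho1 : R; rho2 : R; rho1_gt0 : 0 < rho1; rho2_lt1 : rho2 < 1 }.

(** * Function classes attached to an annulus, and their calculus *)

Section TestFunctions.
Variables (R : realType) (n : nat) (A : radii R).
Local Notation V := 'rV[R]_n.
Local Notation e_ := (@ebasis R n).
Implicit Types (f g p v w : V -> R) (x y : V) (i j k : 'I_n).

Definition annulus x := (rho1 A <= enorm x) && (enorm x <= rho2 A).
Definition Om x := (0 < enorm x) && (enorm x < 1).

Lemma annulusW x : annulus x -> Om x.
Proof. by move=> /andP[a b]; rewrite /Om (lt_le_trans (rho1_gt0 A) a)//= (le_lt_trans b)// rho2_lt1. Qed.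

Definition nsq x : R := \sum_(i < n) x 0 i ^+ 2.

Lemma nsq_ge0 x : 0 <= nsq x.
Proof. by apply: sumr_ge0 => i _; exact: sqr_ge0. Qed.

Lemma enorm_ge0 x : 0 <= enorm x. Proof. exact: sqrtr_ge0. Qed.

Lemma enorm_sqr x : enorm x ^+ 2 = nsq x.
Proof. by rewrite sqr_sqrtr// nsq_ge0. Qed.

Lemma continuous_nsq : continuous nsq.
Proof.
apply: continuous_big => [|i _ x]; first exact: add_continuous.
by have c := @coord_continuous R 1 n 0 i x; exact: (cvgM c c).
Qed.

Lemma continuous_enorm : continuous (@enorm R n).
Proof.
move=> x; apply: (@continuous_comp _ _ _ nsq); first exact: continuous_nsq.
exact: sqrt_continuous.
Qed.

Lemma coord_le_enorm x i : `|x 0 i| <= enorm x.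
Proof.
rewrite -sqrtr_sqr ler_sqrt ?nsq_ge0//; rewrite /nsq (bigD1 i)//= lerDl.
by apply: sumr_ge0 => j _; exact: sqr_ge0.
Qed.

(** Off the annulus a test function vanishes on a whole neighbourhood, so its product with a
    multiplier is regular there, whatever the multiplier does at the origin or on the unit
    sphere. *)
Lemma near_not_annulus x : ~~ annulus x -> \forall y \near x, ~~ annulus y.
Proof.
rewrite negb_and -!ltNge => /orP[h|h].
- near=> y; rewrite negb_and -!ltNge; apply/orP; left.
  near: y; exact: (cvgr_lt _ (@continuous_enorm x)).
- near=> y; rewrite negb_and -!ltNge; apply/orP; right.
  near: y; exact: (cvgr_gt _ (@continuous_enorm x)).
Unshelve. all: by end_near. Qed.

(* [T0], [T1], [T2]: functions of class C^0, C^1, C^2 on the whole space that vanish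
   off the annulus.  [S0 g] and [S1 g dg]: multipliers of class C^0, C^1 on the punctured
   ball [Om] only, [dg] being the gradient of [g]. *)
Definition T0 f := continuous f /\ forall x, ~~ annulus x -> f x = 0.

Definition T1 f := [/\ T0 f, forall i, T0 (partial i f)
  & forall i x, derivable f x (e_ i)].

Definition T2 f := T1 f /\ forall i, T1 (partial i f).

Definition S0 g := forall x, Om x -> {for x, continuous g}.

Definition S1 g (dg : 'I_n -> V -> R) := [/\ S0 g, forall i, S0 (dg i) &
  forall x i, Om x -> is_derive x (e_ i) g (dg i x)].

Lemma T0M f g : T0 f -> S0 g -> T0 (fun x => f x * g x).
Proof.
move=> [cf f0] cg; split=> [x|x ax]; last by rewrite f0 ?mul0r.
have [ax|ax] := boolP (annulus x).
  exact: (cvgM (cf x) (cg x (annulusW ax))).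
have na := near_not_annulus ax.
rewrite /continuous_at f0// mul0r; apply: (@cvg_near_cst _ _ 0 _ (nbhs x)).
by near=> y; rewrite f0 ?mul0r//; near: y.
Unshelve. all: by end_near.
Qed.

Lemma T0D f g : T0 f -> T0 g -> T0 (fun x => f x + g x).
Proof.
move=> [cf f0] [cg g0]; split=> [x|x ax]; last by rewrite f0 ?g0 ?addr0.
exact: (cvgD (cf x) (cg x)).
Qed.

Lemma T0_cst0 : T0 (fun=> 0).
Proof. by split=> //; exact: cst_continuous. Qed.

Lemma T0_sum (I : Type) (r : seq I) (F : I -> V -> R) :
  (forall a, T0 (F a)) -> T0 (fun x => \sum_(a <- r) F a x).
Proof.
move=> TF; elim: r => [|b r IH].
  by under eq_fun do rewrite big_nil; exact: T0_cst0.
by under eq_fun do rewrite big_cons; exact: T0D.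
Qed.

Lemma T0_S0 f : T0 f -> S0 f. Proof. by move=> [cf _] x _; exact: cf. Qed.

Lemma S0_cst (c : R) : S0 (fun=> c). Proof. by move=> x _; exact: cst_continuous. Qed.

Arguments S0_cst : clear implicits.

Lemma S0M f g : S0 f -> S0 g -> S0 (fun x => f x * g x).
Proof. by move=> cf cg x ox; exact: (cvgM (cf x ox) (cg x ox)). Qed.

Lemma S0D f g : S0 f -> S0 g -> S0 (fun x => f x + g x).
Proof. by move=> cf cg x ox; exact: (cvgD (cf x ox) (cg x ox)). Qed.

Lemma S0_coord k : S0 (fun x => x 0 k).
Proof. by move=> x _; exact: coord_continuous. Qed.

Arguments S0_coord : clear implicits.

Lemma T0Z f (c : R) : T0 f -> T0 (fun x => c * f x).
Proof.
move=> Tf; under eq_fun do rewrite mulrC; exact: (T0M Tf (S0_cst c)).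
Qed.

Lemma T1I f df : T0 f -> (forall i, T0 (df i)) ->
  (forall i x, is_derive x (e_ i) f (df i x)) ->
  T1 f /\ forall i, partial i f = df i.
Proof.
move=> Tf Tdf fd.
have E i : partial i f = df i by apply/funext => x; apply: (@derive_val _ _ _ _ _ _ _ (fd i x)).
by split=> //; split=> // i; rewrite E.
Qed.

Lemma T1_is_derive f i x : T1 f -> is_derive x (e_ i) f (partial i f x).
Proof. by case=> _ _ d; apply: derivableP. Qed.

Lemma T1_T0 f : T1 f -> T0 f. Proof. by case. Qed.

Lemma T1_dT0 f i : T1 f -> T0 (partial i f). Proof. by case. Qed.

Lemma T1_S1 f : T1 f -> S1 f (fun i => partial i f).
Proof.
move=> Tf; split; first exact: T0_S0 (T1_T0 Tf).
  by move=> i; exact: T0_S0 (T1_dT0 i Tf).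
by move=> x i _; exact: T1_is_derive.
Qed.

Lemma S1_cst (c : R) : S1 (fun=> c) (fun _ _ => 0).
Proof.
split; [exact: S0_cst|by move=> i; exact: S0_cst|move=> x i _].
exact: is_derive_cst.
Qed.

Lemma S1D f df g dg : S1 f df -> S1 g dg ->
  S1 (fun x => f x + g x) (fun i x => df i x + dg i x).
Proof.
move=> [sf sdf fd] [sg sdg gd]; split; first exact: S0D.
  by move=> i; exact: S0D.
by move=> x i ox; apply: (@is_deriveD _ _ _ f g); [exact: fd|exact: gd].
Qed.

Lemma S1M f df g dg : S1 f df -> S1 g dg ->
  S1 (fun x => f x * g x) (fun i x => df i x * g x + f x * dg i x).
Proof.
move=> [sf sdf fd] [sg sdg gd]; split; first exact: S0M.
  by move=> i; apply: S0D; apply: S0M.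
move=> x i ox.
have := @is_deriveM _ _ f g x (e_ i) _ _ (fd x i ox) (gd x i ox).
by move=> h; apply: is_derive_eq h _; rewrite addrC mulrC.
Qed.

Lemma S1_sum (I : Type) (r : seq I) (F : I -> V -> R) dF :
  (forall a, S1 (F a) (dF a)) ->
  S1 (fun x => \sum_(a <- r) F a x) (fun j x => \sum_(a <- r) dF a j x).
Proof.
move=> TF; elim: r => [|b r IH].
  have -> : (fun x => \sum_(a <- [::]) F a x) = (fun=> 0).
    by apply/funext => x; rewrite big_nil.
  have -> : (fun (j : 'I_n) x => \sum_(a <- [::]) dF a j x) = (fun _ _ => 0).
    by apply/funext => j; apply/funext => x; rewrite big_nil.
  exact: S1_cst.
have -> : (fun x => \sum_(a <- b :: r) F a x) = (fun x => F b x + \sum_(a <- r) F a x).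
  by apply/funext => x; rewrite big_cons.
have -> : (fun (j : 'I_n) x => \sum_(a <- b :: r) dF a j x) =
    (fun j x => dF b j x + \sum_(a <- r) dF a j x).
  by apply/funext => j; apply/funext => x; rewrite big_cons.
exact: S1D.
Qed.

Lemma S1_comp (h h' : R -> R) g dg : S1 g dg ->
  (forall x, Om x -> is_derive (g x) 1 h (h' (g x))) ->
  (forall x, Om x -> {for g x, continuous h'}) ->
  S1 (fun x => h (g x)) (fun i x => h' (g x) * dg i x).
Proof.
move=> [sg sdg gd] hd ch'.
split.
- move=> x ox; apply: (@continuous_comp _ _ _ g h); first exact: sg.
  apply/differentiable_continuous/derivable1_diffP.
  exact: (@ex_derive _ _ _ _ _ _ _ (hd x ox)).
- move=> i; apply: S0M => // x ox.
  by apply: (@continuous_comp _ _ _ g h'); [exact: sg|exact: ch'].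
- move=> x i ox; apply: is_derive_comp1; [exact: gd|exact: hd].
Qed.

Lemma S1_coord k : S1 (fun x => x 0 k) (fun i _ => (i == k)%:R).
Proof.
split; [exact: S0_coord|by move=> i; exact: S0_cst|move=> x i _].
apply: line_is_derive.
have -> : (fun s : R => (s *: e_ i + x) 0 k) = (fun s : R => s * (i == k)%:R + x 0 k).
  by apply/funext => s; rewrite !mxE eqxx eq_sym.
have h1 := @is_deriveM _ _ id (cst (i == k)%:R) (0 : R) 1 _ _
  (is_derive_id _ _) (is_derive_cst _ _ _).
have := is_deriveD h1 (is_derive_cst (x 0 k) (0 : R) (1 : R)).
move=> h; apply: is_derive_eq h _.
by rewrite addr0 scaler0 add0r [_ *: 1]mulr1.
Qed.

Lemma S1_eq g dg dg' : S1 g dg -> (forall i x, dg i x = dg' i x) -> S1 g dg'.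
Proof. by move=> H E; rewrite (_ : dg' = dg)//; apply/funext => i; apply/funext. Qed.

Lemma S1_nsq : S1 nsq (fun i x => 2 * x 0 i).
Proof.
apply: S1_eq (S1_sum _ (fun k => S1M (S1_coord k) (S1_coord k))) _ => i x /=.
rewrite (bigD1 i)//= big1 ?addr0 ?eqxx; first by rewrite mul1r mulr1; ring.
by move=> k ki; rewrite eq_sym (negbTE ki) mul0r mulr0 addr0.
Qed.

Lemma nsq_gt0 x : Om x -> 0 < nsq x.
Proof. by move=> /andP[x0 _]; rewrite -enorm_sqr exprn_gt0. Qed.

Lemma continuousV1 (h : R -> R) t : {for t, continuous h} -> h t != 0 ->
  {for t, continuous (fun s => (h s)^-1)}.
Proof. by move=> c h0; apply: cvgV. Qed.

Lemma S1_enorm : S1 (@enorm R n) (fun i x => x 0 i / enorm x).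
Proof.
apply: S1_eq; first apply: (@S1_comp Num.sqrt (fun t => (2 * Num.sqrt t)^-1)).
- exact: S1_nsq.
- by move=> x /nsq_gt0 x0; exact: is_derive1_sqrt.
- move=> x /nsq_gt0 x0; apply: continuousV1.
    by apply: cvgM; [exact: cvg_cst|exact: sqrt_continuous].
  by rewrite mulf_neq0// gt_eqF// sqrtr_gt0.
- by move=> i x /=; rewrite invfM -/(enorm x) mulrACA mulVf// mul1r mulrC.
Qed.

Lemma S1_powR (s : R) : S1 (fun x => enorm x `^ s)
  (fun i x => s * enorm x `^ (s - 1) * (x 0 i / enorm x)).
Proof.
apply: (@S1_comp (fun t => t `^ s) (fun t => s * t `^ (s - 1))).
- exact: S1_enorm.
- by move=> x /andP[x0 _]; exact: is_derive1_powR.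
- move=> x /andP[x0 _].
  suff c : {for enorm x, continuous (fun t => t `^ (s - 1))}.
    exact: (cvgM (@cvg_cst _ _ _ _ _) c).
  apply/differentiable_continuous/derivable1_diffP.
  exact: (@ex_derive _ _ _ _ _ _ _ (is_derive1_powR (s - 1) x0)).
Qed.

Lemma S1_ln : S1 (fun x => ln (enorm x)) (fun i x => (enorm x)^-1 * (x 0 i / enorm x)).
Proof.
apply: (@S1_comp (@ln R) (fun t => t^-1)).
- exact: S1_enorm.
- by move=> x /andP[x0 _]; exact: is_derive1_ln.
- by move=> x /andP[x0 _]; apply: inv_continuous; rewrite gt_eqF.
Qed.

Lemma T1M f g dg : T1 f -> S1 g dg -> T1 (fun x => f x * g x) /\
  forall i, partial i (fun x => f x * g x) =
    (fun x => partial i f x * g x + f x * dg i x).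
Proof.
move=> Tf Sg; have [sg sdg gd] := Sg; apply: T1I.
- by apply: T0M => //; exact: T1_T0.
- by move=> i; apply: T0D; apply: T0M => //; [exact: T1_dT0|exact: T1_T0].
- move=> i x; have [ax|ax] := boolP (annulus x).
    have := @is_deriveM _ _ f g x (e_ i) _ _ (T1_is_derive i x Tf) (gd x i (annulusW ax)).
    by move=> h; apply: is_derive_eq h _; rewrite addrC mulrC.
  have [_ f0] := T1_T0 Tf; have [_ df0] := T1_dT0 i Tf.
  have na := near_not_annulus ax.
  rewrite f0// df0// !mul0r addr0.
  apply: (@near_eq_is_derive _ _ _ (cst (0 : R)) _ _ _ (0 : R)).
  by near=> y; rewrite f0 ?mul0r//; near: y.
Unshelve. all: by end_near. Qed.

Lemma T1D f g : T1 f -> T1 g -> T1 (fun x => f x + g x) /\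
  forall i, partial i (fun x => f x + g x) = (fun x => partial i f x + partial i g x).
Proof.
move=> Tf Tg; apply: T1I.
- by apply: T0D; exact: T1_T0.
- by move=> i; apply: T0D; exact: T1_dT0.
- by move=> i x; apply: (@is_deriveD _ _ _ f g); exact: T1_is_derive.
Qed.

Lemma T1_cst0 : T1 (fun=> 0) /\ forall i, partial i (fun=> 0) = (fun=> 0 : R).
Proof.
by apply: T1I => [|i]; exact: T0_cst0.
Qed.

Lemma T1Z f (c : R) : T1 f -> T1 (fun x => c * f x) /\
  forall i, partial i (fun x => c * f x) = (fun x => c * partial i f x).
Proof.
move=> Tf; have [T E] := T1M Tf (S1_cst c).
have Ec : (fun x => c * f x) = (fun x => f x * c) by apply/funext => x; exact: mulrC.
rewrite Ec; split=> // i; rewrite E; apply/funext => x.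
by rewrite mulr0 addr0 mulrC.
Qed.

Lemma T1_sum (I : Type) (r : seq I) (F : I -> V -> R) : (forall a, T1 (F a)) ->
  T1 (fun x => \sum_(a <- r) F a x) /\
  forall i, partial i (fun x => \sum_(a <- r) F a x) =
    (fun x => \sum_(a <- r) partial i (F a) x).
Proof.
move=> TF; elim: r => [|b r [IH1 IH2]].
  have -> : (fun x => \sum_(a <- [::]) F a x) = (fun=> 0).
    by apply/funext => x; rewrite big_nil.
  have [T E] := T1_cst0; split=> // i.
  by rewrite E; apply/funext => x; rewrite big_nil.
have -> : (fun x => \sum_(a <- b :: r) F a x) = (fun x => F b x + \sum_(a <- r) F a x).
  by apply/funext => x; rewrite big_cons.
have [T E] := T1D (TF b) IH1; split=> // i.
by rewrite E; apply/funext => x; rewrite IH2 big_cons.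
Qed.

(** Unlike [T0], this class of integrands is stable under translations, up to a larger [M]. *)
Definition UB M f := unifc f /\ box_supp 0 M f.

Lemma ballP x (d : R) y : (forall i, `|x 0 i - y 0 i| < d) -> 0 < d -> ball x d y.
Proof. by move=> H d0; split=> // i j; rewrite (ord1 i); exact: H. Qed.

Lemma T0_box f : T0 f -> box_supp 0 1 f.
Proof.
move=> [_ f0] x i _ xi; apply: f0; rewrite negb_and -!ltNge; apply/orP; right.
by rewrite (lt_trans (rho2_lt1 A))// (lt_le_trans xi)// coord_le_enorm.
Qed.

Definition cube (M : R) : set V := [set x | forall i, `[- M, M]%classic (x 0 i)].

Lemma compact_cube M : compact (cube M).
Proof. by apply: (rV_compact (A := fun=> _)) => i; exact: segment_compact. Qed.

Lemma T0_unifc f : T0 f -> unifc f.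
Proof.
move=> Tf e e0; have f0 := T0_box Tf; have [cf _] := Tf.
have [d d0 H] : exists2 d, 0 < d & forall x, cube 2 x ->
    forall y, ball x d y -> `|f x - f y| <= e.
  have /compact_near_coveringP/(_ R (0:R)^'+
    (fun d x => forall y, ball x d y -> `|f x - f y| <= e)) := @compact_cube 2.
  case.
    move=> x _.
    have /cvgrPdist_le/(_ (e / 2)) := cf x; rewrite divr_gt0// => /(_ isT).
    move=> /nbhs_ballP[r r0 Hr].
    exists (ball x (r / 2), [set d | d < r / 2]) => /=.
      split; first by apply: nbhsx_ballx; rewrite divr_gt0.
      by apply: nbhs_right_lt; rewrite divr_gt0.
    move=> [x' d] [/= xx' dr] y x'y.
    have h1 : `|f x - f x'| <= e / 2.
      by apply: Hr; apply: le_ball xx'; rewrite ler_pdivrMr// ler_pMr// ler1n.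
    have h2 : `|f x - f y| <= e / 2.
      apply: Hr; rewrite [r]splitr; apply: ball_triangle xx' _.
      by apply: le_ball x'y; exact: ltW.
    rewrite (_ : f x' - f y = (f x - f y) - (f x - f x')); last by ring.
    by rewrite (le_trans (ler_normB _ _))// [e]splitr lerD.
  move=> d /= d0 H; exists (d / 2); first by rewrite divr_gt0.
  apply: H => /=; last by rewrite divr_gt0.
  by rewrite /ball/= sub0r normrN gtr0_norm ?divr_gt0// ltr_pdivrMr// ltr_pMr// ltr1n.
(* Compactness handles the points of the cube of half-side 2. For [x] outside it, a distance below 1
   leaves [y] outside the cube of half-side 1, and [f] vanishes at both. *)
exists (Num.min d 1); first by rewrite lt_min d0/=.
move=> x y xy; have [cx|] := pselect (cube 2 x).
  apply: H => //; apply: ballP => // i.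
  by rewrite (lt_le_trans (xy i))// ge_min lexx.
move=> /existsNP[i xi].
have {}xi : 2 < `|x 0 i|.
  rewrite ltNge; apply/negP => h; apply: xi => /=.
  by rewrite in_itv/= -ler_norml.
have x1 : `|x 0 i - y 0 i| < 1.
  by rewrite (lt_le_trans (xy i))// ge_min lexx orbT.
rewrite (f0 x i)//; last lra.
rewrite (f0 y i)// ?subrr ?normr0 ?ltW//.
have := ler_normD (x 0 i - y 0 i) (y 0 i); rewrite subrK; lra.
Qed.

Lemma T0_UB f : T0 f -> UB 1 f.
Proof. by move=> Tf; split; [exact: T0_unifc|exact: T0_box]. Qed.

Lemma T0_bounded f : T0 f -> exists2 c, 0 < c & forall x, `|f x| <= c.
Proof.
move=> Tf; have [cf _] := Tf.
have cn : continuous (fun x => `|f x|).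
  by move=> x; exact: (cvg_norm (cf x)).
have ne : (cube 1 !=set0) by exists 0 => i /=; rewrite mxE in_itv/= oppr_le0 ler01.
have [c _ H] := compact_EVT_max ne (@compact_cube 1) (continuous_subspaceT cn).
exists (`|f c| + 1); first by rewrite ltr_wpDl.
move=> x; have [cx|] := pselect (cube 1 x).
  by rewrite (le_trans (H x _)) ?inE// lerDl.
move=> /existsNP[i xi]; rewrite (T0_box Tf (i := i))// ?normr0 ?addr_ge0//.
rewrite ltNge; apply/negP => h; apply: xi => /=.
by rewrite in_itv/= -ler_norml.
Qed.

End TestFunctions.

(** * Integration by parts *)

Section Integration.
Variables (R : realType) (n : nat) (A : radii R).
Local Notation V := 'rV[R]_n.
Local Notation e_ := (@ebasis R n).
Local Notation T0 := (@T0 R n A).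
Local Notation T1 := (@T1 R n A).
Local Notation T2 := (@T2 R n A).
Local Notation int := (@integralRn R n).
Implicit Types (f g p v w : V -> R) (x y : V) (i j k : 'I_n).

Lemma UBW M N f : M <= N -> UB M f -> UB N f.
Proof. by move=> MN [u s]; split=> // x i _ xi; apply: (s x i) => //; exact: le_lt_trans xi. Qed.

Lemma UB_lin M f g (a b : R) : UB M f -> UB M g -> UB M (fun x => a * f x + b * g x).
Proof.
move=> [uf sf] [ug sg]; split=> [e e0|x i ki xi]; last first.
  by rewrite (sf x i)// (sg x i)// !mulr0 addr0.
have c0 : 0 < `|a| + `|b| + 1 by rewrite ltr_wpDl// addr_ge0.
have [d d0 H] := uf _ (divr_gt0 e0 c0); have [d' d'0 H'] := ug _ (divr_gt0 e0 c0).
exists (Num.min d d'); first by rewrite lt_min d0.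
move=> x y xy.
have h : `|f x - f y| <= e / (`|a| + `|b| + 1).
  by apply: H => i; rewrite (lt_le_trans (xy i))// ge_min lexx.
have h' : `|g x - g y| <= e / (`|a| + `|b| + 1).
  by apply: H' => i; rewrite (lt_le_trans (xy i))// ge_min lexx orbT.
have -> : a * f x + b * g x - (a * f y + b * g y) = a * (f x - f y) + b * (g x - g y) by ring.
rewrite (le_trans (ler_normD _ _))// !normrM.
have -> : e = `|a| * (e / (`|a| + `|b| + 1)) + `|b| * (e / (`|a| + `|b| + 1))
    + e / (`|a| + `|b| + 1).
  by field; rewrite gt_eqF.
apply: ler_wpDr; first by rewrite divr_ge0 ?ltW.
by apply: lerD; apply: ler_wpM2l.
Qed.

Lemma int_lin M f g (a b : R) : 0 <= M -> UB M f -> UB M g ->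
  int (fun x => a * f x + b * g x) = a * int f + b * int g.
Proof. by move=> M0 [uf sf] [ug sg]; apply: (iter_integral_lin (M := M)). Qed.

Lemma intD f g : T0 f -> T0 g -> int (fun x => f x + g x) = int f + int g.
Proof.
move=> /(T0_UB) Uf /(T0_UB) Ug.
rewrite -[int f]mul1r -[int g]mul1r -(int_lin _ _ ler01)//.
by apply: eq_iter_integral => x; rewrite !mul1r.
Qed.

Lemma intZ f (c : R) : T0 f -> int (fun x => c * f x) = c * int f.
Proof.
move=> /(T0_UB) Uf.
rewrite -[RHS]addr0 -[X in _ = _ + X](mul0r (int f)) -(int_lin _ _ ler01)//.
by apply: eq_iter_integral => x; rewrite mul0r addr0.
Qed.

Lemma int_sum (I : Type) (r : seq I) (F : I -> V -> R) : (forall a, T0 (F a)) ->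
  int (fun x => \sum_(a <- r) F a x) = \sum_(a <- r) int (F a).
Proof.
move=> TF; elim: r => [|b r IH].
  (* The zero function is written as a multiple of itself so that [intZ] evaluates its integral. *)
  have -> : (fun x => \sum_(a <- [::]) F a x) = (fun=> 0 * 0).
    by apply/funext => x; rewrite big_nil mul0r.
  by rewrite (@intZ (fun=> 0)) ?big_nil ?mul0r//; exact: T0_cst0.
rewrite big_cons -IH -intD//; last exact: T0_sum.
by apply: eq_iter_integral => x; rewrite big_cons.
Qed.

Lemma int_ge0 f : (forall x, 0 <= f x) -> 0 <= int f.
Proof. exact: iter_integral_ge0. Qed.

Lemma int_bound M f (c : R) : 0 <= M -> 0 <= c -> UB M f -> (forall x, `|f x| <= c) ->
  `|int f| <= c * (2 * M) ^+ n.
Proof. by move=> M0 c0 [uf sf] fc; apply: iter_integral_bound. Qed.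

Lemma eq_int f g : f =1 g -> int f = int g.
Proof. by move=> /funext ->. Qed.

Lemma shiftE i (h : R) x : h *: e_ i + x = coordmap i (fun t => t + h) x.
Proof.
apply/rowP => j; rewrite !mxE eqxx/=; case: (eqVneq j i) => [->|ji].
  by rewrite mulr1 addrC eqxx.
by move: ji; rewrite mulr0 add0r -val_eqE/= => /negbTE ->.
Qed.

Lemma int_shift M f i (h : R) : 0 <= M -> UB M f ->
  int (fun x => f (h *: e_ i + x)) = int f.
Proof.
move=> M0 [uf sf]; rewrite -[RHS](@iter_integral_coordmap _ _ M f i (fun t => t + h) M0 uf sf).
  by apply: eq_iter_integral => x /=; rewrite shiftE.
by move=> g cg g0; exact: Rintegral_shift cg g0.
Qed.

#[local] Opaque integralRn.

Lemma UB_shift f i (h : R) : `|h| <= 1 -> UB 1 f -> UB 2 (fun x => f (h *: e_ i + x)).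
Proof.
move=> h1 [uf sf]; split=> [e e0|x j _ xj].
  have [d d0 H] := uf e e0; exists d => // x y xy; apply: H => j.
  by rewrite !mxE opprD addrACA subrr add0r.
apply: (sf _ j) => //; rewrite !mxE eqxx/=.
set b := (_ == _); have hb : `|h * b%:R| <= 1.
  by case: b; rewrite ?mulr1// mulr0 normr0.
have := ler_normB (h * b%:R + x 0 j) (h * b%:R); rewrite addrAC subrr add0r; lra.
Qed.

(** The mean value theorem and the uniform continuity of the derivative make difference quotients
    converge uniformly, which is what passing to the limit under the integral requires. *)
Lemma diff_quotient f i (e : R) : T1 f -> 0 < e ->
  exists2 d, 0 < d & forall h, `|h| < d -> forall x,
    `|f (h *: e_ i + x) - f x - h * partial i f x| <= e * `|h|.
Proof.
move=> Tf e0; have [d d0 H] := T0_unifc (T1_dT0 i Tf) e0.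
exists d => // h hd x.
have [c ch ->] : exists2 c, `|c| <= `|h| &
    f (h *: e_ i + x) - f x = h * 'D_(e_ i) f (c *: e_ i + x).
  by apply: MVT_line => y; case: Tf.
rewrite -/(partial i f _) -mulrBr normrM mulrC ler_wpM2r//.
apply: H => j; rewrite !mxE addrK eqxx/=.
apply: le_lt_trans hd; apply: le_trans ch.
by case: (_ == _); rewrite ?mulr1// mulr0 normr0.
Qed.

Lemma le_all_eps (a c : R) : 0 <= c -> (forall e, 0 < e -> a <= e * c) -> a <= 0.
Proof.
move=> c0 H; rewrite leNgt; apply/negP => a0.
have c1 : 0 < 2 * (c + 1) by rewrite mulr_gt0// ltr_wpDl.
have := H _ (divr_gt0 a0 c1); rewrite mulrAC ler_pdivlMr// ler_pM2l//.
by apply/negP; rewrite -ltNge; nra.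
Qed.

(** By translation invariance the increment [f (x + h e_i) - f x] has integral zero, and it differs
    from [h * partial i f] by at most [e * |h|] on a fixed box. *)
Lemma int_partial f i : T1 f -> int (partial i f) = 0.
Proof.
(* [4 ^+ n] is the volume of the box of half-side 2, which contains the support of [f] and of its
   translates by at most 1. *)
move=> Tf; apply/eqP; rewrite -normr_le0; apply: (@le_all_eps _ (4 ^+ n)).
  by rewrite exprn_ge0.
move=> e e0; have [d d0 H] := diff_quotient i Tf e0.
pose h := Num.min (d / 2) 1.
have h0 : 0 < h by rewrite lt_min divr_gt0//=.
have hd : `|h| < d.
  by rewrite gtr0_norm// gt_min ltr_pdivrMr// ltr_pMr// ltr1n.
have h1 : `|h| <= 1 by rewrite gtr0_norm// ge_min lexx orbT.
have Uf := T0_UB (T1_T0 Tf); have U2f := UBW (ler1n _ 2) Uf.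
have U2d := UBW (ler1n _ 2) (T0_UB (T1_dT0 i Tf)).
have U2s := UB_shift i h1 Uf.
have two0 : 0 <= 2 :> R by [].
have E : int (fun x => f (h *: e_ i + x) - f x - h * partial i f x) = - h * int (partial i f).
  transitivity (int (fun x => 1 * (1 * f (h *: e_ i + x) + -1 * f x) + - h * partial i f x)).
    by apply: eq_int => x; ring.
  have Us : UB 2 (fun x => 1 * f (h *: e_ i + x) + -1 * f x).
    exact: UB_lin.
  by rewrite (int_lin _ _ two0 Us U2d) (int_lin _ _ two0 U2s U2f) (int_shift _ _ ler01 Uf); ring.
have B : `|int (fun x => f (h *: e_ i + x) - f x - h * partial i f x)| <= e * `|h| * (2 * 2) ^+ n.
  apply: int_bound => //.
  - by rewrite mulr_ge0// ltW.
  - have -> : (fun x => f (h *: e_ i + x) - f x - h * partial i f x) =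
      (fun x => 1 * (1 * f (h *: e_ i + x) + -1 * f x) + - h * partial i f x).
      by apply/funext => x; ring.
    by apply: UB_lin => //; exact: UB_lin.
  - exact: H.
move: B; rewrite E normrM normrN mulrAC [X in X <= _]mulrC ler_pM2r ?normr_gt0 ?gt_eqF//.
by rewrite -natrM.
Qed.

Lemma T0_mul f g : T0 f -> T0 g -> T0 (fun x => f x * g x).
Proof. by move=> Tf Tg; apply: T0M => //; exact: T0_S0 Tg. Qed.

Lemma T1_mul f g : T1 f -> T1 g -> T1 (fun x => f x * g x) /\
  forall i, partial i (fun x => f x * g x) =
    (fun x => partial i f x * g x + f x * partial i g x).
Proof. by move=> Tf Tg; apply: T1M => //; exact: T1_S1 Tg. Qed.

Lemma continuous_shift f i (h : R) : continuous f -> continuous (fun x => f (h *: e_ i + x)).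
Proof.
move=> cf x; apply: (@continuous_comp _ _ _ (fun x => h *: e_ i + x) f); last exact: cf.
exact: (cvgD (@cvg_cst _ _ _ _ _) (@cvg_id _ _)).
Qed.

Lemma is_derive_translate f i j (h : R) x : T1 f ->
  is_derive x (e_ i) (fun y => f (h *: e_ j + y)) (partial i f (h *: e_ j + x)).
Proof.
move=> Tf; apply: line_is_derive.
have -> : (fun s : R => f (h *: e_ j + (s *: e_ i + x))) =
    (fun s : R => f (s *: e_ i + (h *: e_ j + x))).
  by apply/funext => s; rewrite addrCA.
by apply: is_derive_line; rewrite scale0r add0r; exact: T1_is_derive Tf.
Qed.

Lemma S1_shift f j (h : R) : T1 f ->
  S1 (fun x => f (h *: e_ j + x)) (fun i x => partial i f (h *: e_ j + x)).
Proof.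
move=> Tf; split.
- by move=> x _; apply: continuous_shift; case: Tf => -[].
- by move=> i x _; apply: continuous_shift; have [] := T1_dT0 i Tf.
- by move=> x i _; exact: is_derive_translate.
Qed.

(** Integration by parts moves the derivative onto the increment of [v]; a translation then moves
    the increment onto [p], reversing the sign of [h]. *)
Lemma int_partial_shift p v i j (h : R) : T1 p -> T1 v ->
  int (fun x => partial i p x * (v (h *: e_ j + x) - v x)) =
  - int (fun x => (p (- h *: e_ j + x) - p x) * partial i v x).
Proof.
move=> Tp Tv.
have [Tpv Epv] := T1_mul Tp Tv; have [Tps Eps] := T1M Tp (S1_shift j h Tv).
have T0p := T1_T0 Tp; have T0v := T1_T0 Tv.
have dp := T1_dT0 i Tp; have dv := T1_dT0 i Tv.
have cp := proj1 T0p; have cv := proj1 T0v; have cdv := proj1 dv.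
have I1 := int_partial i Tpv; have I2 := int_partial i Tps.
rewrite Epv intD in I1; [|exact: T0_mul..].
have S0s f : T0 f -> S0 (fun x => f (h *: e_ j + x)).
  by move=> [cf _] x _; exact: continuous_shift.
have S0s' f : T0 f -> S0 (fun x => f (- h *: e_ j + x)).
  by move=> [cf _] x _; exact: continuous_shift.
rewrite Eps intD in I2; [|by apply: T0M => //; exact: S0s..].
have -> : int (fun x => partial i p x * (v (h *: e_ j + x) - v x)) =
    int (fun x => partial i p x * v (h *: e_ j + x)) + -1 * int (fun x => partial i p x * v x).
  rewrite -intZ; last exact: T0_mul.
  rewrite -intD; [|by apply: T0M => //; exact: S0s|by apply: T0Z; exact: T0_mul].
  by apply: eq_int => x; ring.
have -> : int (fun x => (p (- h *: e_ j + x) - p x) * partial i v x) =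
    int (fun x => partial i v x * p (- h *: e_ j + x)) + -1 * int (fun x => p x * partial i v x).
  rewrite -intZ; last exact: T0_mul.
  rewrite -intD; [|by apply: T0M => //; exact: S0s'|by apply: T0Z; exact: T0_mul].
  by apply: eq_int => x; ring.
have E : int (fun x => p x * partial i v (h *: e_ j + x)) =
    int (fun x => partial i v x * p (- h *: e_ j + x)).
  have U : UB 1 (fun x => partial i v x * p (- h *: e_ j + x)).
    by apply: (T0_UB (A := A)); apply: T0M => //; exact: S0s'.
  rewrite -(int_shift j h ler01 U); apply: eq_int => x.
  by rewrite scaleNr addKr mulrC.
rewrite E in I2; lra.
Qed.

(** This is [int_partial_shift] divided by [h], in the limit [h -> 0]; no second derivative is ever
    formed. *)
Lemma int_partial_sym p v i j : T1 p -> T1 v ->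
  int (fun x => partial i p x * partial j v x) =
  int (fun x => partial j p x * partial i v x).
Proof.
move=> Tp Tv.
have [c c0 pc] := T0_bounded (T1_dT0 i Tp).
have [c' c'0 vc] := T0_bounded (T1_dT0 i Tv).
apply/eqP; rewrite -subr_eq0 -normr_le0.
apply: (@le_all_eps _ ((c + c') * (2 * 1) ^+ n)).
  by rewrite mulr_ge0 ?exprn_ge0 ?mulr_ge0// addr_ge0// ltW.
move=> e e0.
have [d d0 H] := diff_quotient j Tv e0; have [d' d'0 H'] := diff_quotient j Tp e0.
pose h := Num.min d d' / 2.
have h0 : 0 < h by rewrite divr_gt0// lt_min d0.
have hm : h < Num.min d d' by rewrite ltr_pdivrMr// ltr_pMr ?ltr1n// lt_min d0.
have hd : `|h| < d by rewrite gtr0_norm// (lt_le_trans hm)// ge_min lexx.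
have hd' : `|- h| < d' by rewrite normrN gtr0_norm// (lt_le_trans hm)// ge_min lexx orbT.
(* [D] and [B] are the errors made on the two sides of [int_partial_shift] when increments are
   replaced by [h] or [- h] times a derivative. Their integrals are bounded by multiples of
   [e * |h|]. *)
pose D x := partial i p x * (v (h *: e_ j + x) - v x - h * partial j v x).
pose B x := (p (- h *: e_ j + x) - p x - - h * partial j p x) * partial i v x.
have T0v := T1_T0 Tv; have T0p := T1_T0 Tp.
have dpi := T1_dT0 i Tp; have dpj := T1_dT0 j Tp.
have dvi := T1_dT0 i Tv; have dvj := T1_dT0 j Tv.
have S0s f (k : R) : T0 f -> S0 (fun x => f (k *: e_ j + x)).
  by move=> [cf _] x _; exact: continuous_shift.
have TA0 : T0 (fun x => partial i p x * (v (h *: e_ j + x) - v x)).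
  apply: T0M => //; apply: S0D; first exact: S0s.
  by have := T0_S0 (T0Z (-1) T0v); under eq_fun do rewrite mulN1r.
have TB0 : T0 (fun x => (p (- h *: e_ j + x) - p x) * partial i v x).
  under eq_fun do rewrite mulrC.
  apply: T0M => //; apply: S0D; first exact: S0s.
  by have := T0_S0 (T0Z (-1) T0p); under eq_fun do rewrite mulN1r.
have Tij : T0 (fun x => partial i p x * partial j v x) by exact: T0_mul.
have Tji : T0 (fun x => partial j p x * partial i v x) by exact: T0_mul.
have EA x : D x = partial i p x * (v (h *: e_ j + x) - v x) +
    (- h) * (partial i p x * partial j v x) by rewrite /D; ring.
have EB x : B x = (p (- h *: e_ j + x) - p x) * partial i v x +
    h * (partial j p x * partial i v x) by rewrite /B; ring.
have TA : T0 D by rewrite (funext EA); apply: T0D => //; exact: T0Z.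
have TB : T0 B by rewrite (funext EB); apply: T0D => //; exact: T0Z.
have bA : `|int D| <= c * (e * `|h|) * (2 * 1) ^+ n.
  apply: int_bound => //; [by rewrite !mulr_ge0// ltW|exact: T0_UB TA|].
  by move=> x; rewrite normrM ler_pM//; exact: H.
have bB : `|int B| <= (e * `|h|) * c' * (2 * 1) ^+ n.
  apply: int_bound => //; [by rewrite !mulr_ge0// ltW|exact: T0_UB TB|].
  by move=> x; rewrite normrM ler_pM// -(normrN h); exact: H'.
have E : h * (int (fun x => partial i p x * partial j v x) -
    int (fun x => partial j p x * partial i v x)) = - int D - int B.
  have ED : int D = int (fun x => partial i p x * (v (h *: e_ j + x) - v x)) +
      - h * int (fun x => partial i p x * partial j v x).
    apply: etrans (congr1 int (funext EA)) _; apply: etrans (intD TA0 (T0Z _ Tij)) _.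
    exact: congr1 (intZ _ Tij).
  have EB' : int B = int (fun x => (p (- h *: e_ j + x) - p x) * partial i v x) +
      h * int (fun x => partial j p x * partial i v x).
    apply: etrans (congr1 int (funext EB)) _; apply: etrans (intD TB0 (T0Z _ Tji)) _.
    exact: congr1 (intZ _ Tji).
  have lin_solve (s t a a' b b' : R) : s = a + - h * b -> t = a' + h * b' -> a = - a' ->
    h * (b - b') = - s - t by move=> -> -> ->; ring.
  exact: (lin_solve _ _ _ _ _ _ ED EB' (int_partial_shift i j h Tp Tv)).
have hp : 0 < `|h| by rewrite normr_gt0 gt_eqF.
rewrite -(ler_pM2l hp) -normrM E (le_trans (ler_normB _ _))// normrN.
by rewrite (le_trans (lerD bA bB))// le_eqVlt; apply/orP; left; apply/eqP; ring.
Qed.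

End Integration.

(** * Linear vector fields *)

#[local] Opaque integralRn partial.

Section Fields.
Variables (R : realType) (n : nat) (A : radii R).
Local Notation V := 'rV[R]_n.
Local Notation e_ := (@ebasis R n).
Local Notation T0 := (@T0 R n A).
Local Notation T1 := (@T1 R n A).
Local Notation T2 := (@T2 R n A).
Local Notation int := (@integralRn R n).
Implicit Types (f g p v w : V -> R) (x y : V) (i j k : 'I_n) (B C : 'M[R]_n).

(** The mean value theorem is used twice, first along [e_ i] on the increment [phi] along [e_ j].
    The two displacements add up when [i = j], hence the factor 2 in the distance to [z]. *)
Lemma second_difference w i j (h : R) x : T2 w ->
  exists2 z : V, forall k, `|x 0 k - z 0 k| <= 2 * `|h| &
   w (h *: e_ i + (h *: e_ j + x)) - w (h *: e_ j + x) - w (h *: e_ i + x) + w x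
   = h * (h * partial j (partial i w) z).
Proof.
move=> [Tw Tdw]; pose phi y := w (h *: e_ j + y) - w y.
have dphi y : is_derive y (e_ i) phi (partial i w (h *: e_ j + y) - partial i w y).
  apply: (@is_deriveB _ _ _ (fun y => w (h *: e_ j + y)) w).
    exact: is_derive_translate Tw.
  exact: T1_is_derive Tw.
have [c ch Ec] := @MVT_line _ _ phi (e_ i) x h (fun y => @ex_derive _ _ _ _ _ _ _ (dphi y)).
have [c' ch' Ec'] := @MVT_line _ _ (partial i w) (e_ j) (c *: e_ i + x) h
  (fun y => @ex_derive _ _ _ _ _ _ _ (T1_is_derive j y (Tdw i))).
exists (c' *: e_ j + (c *: e_ i + x)).
  move=> k; rewrite !mxE eqxx/= addrA opprD addrCA subrr addr0 normrN.
  rewrite (le_trans (ler_normD _ _))// mulr_natl mulr2n.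
  by apply: lerD; [case: (k == j)|case: (k == i)]; rewrite ?mulr1 ?mulr0 ?normr0.
rewrite -/(partial j (partial i w) _) in Ec'.
rewrite -Ec'; move: Ec; rewrite (@derive_val _ _ _ _ _ _ _ (dphi _)) => <-.
rewrite /phi [h *: e_ j + (_ + _)]addrCA.
move: (w (h *: e_ i + (h *: e_ j + x))) (w (h *: e_ j + x)) (w (h *: e_ i + x)) (w x).
by move=> a b a' b'; ring.
Qed.

Lemma partial_comm w i j : T2 w -> partial j (partial i w) = partial i (partial j w).
Proof.
move=> Tw; apply/funext => x; have [_ Tdw] := Tw.
apply/eqP; rewrite -subr_eq0 -normr_le0; apply: (@le_all_eps _ _ 2) => // e e0.
have [d d0 H] := T0_unifc (T1_dT0 j (Tdw i)) e0.
have [d' d'0 H'] := T0_unifc (T1_dT0 i (Tdw j)) e0.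
pose h := Num.min d d' / 4.
have m0 : 0 < Num.min d d' by rewrite lt_min d0.
have h0 : 0 < h by rewrite divr_gt0.
have h2 : 2 * `|h| < Num.min d d' by rewrite gtr0_norm// /h; lra.
have [z1 b1 E1] := second_difference i j h x Tw.
have [z2 b2 E2] := second_difference j i h x Tw.
have md : Num.min d d' <= d by rewrite ge_min lexx.
have md' : Num.min d d' <= d' by rewrite ge_min lexx orbT.
have n1 := H x z1 (fun k => lt_le_trans (le_lt_trans (b1 k) h2) md).
have n2 := H' x z2 (fun k => lt_le_trans (le_lt_trans (b2 k) h2) md').
have hn : h != 0 by rewrite gt_eqF.
rewrite [h *: e_ j + (_ + _)]addrCA in E2.
(* The second difference is symmetric in [i] and [j]; both values are that same number divided by
   [h ^ 2]. *)
have E : partial j (partial i w) z1 = partial i (partial j w) z2.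
  apply: (mulfI hn); apply: (mulfI hn); apply: etrans (esym E1) _.
  by apply: etrans E2; congr (_ + _); exact: addrAC.
rewrite E in n1; move: n1 n2.
move: (partial j (partial i w) x) (partial i (partial j w) x) (partial i (partial j w) z2).
move=> a b c n1 n2; rewrite (_ : a - b = (a - c) - (b - c)); last by ring.
apply: le_trans (ler_normB _ _) _; rewrite mulr_natr mulr2n; exact: lerD n1 n2.
Qed.

Definition lin B i x : R := (x *m B) 0 i.

(** The derivation along a linear vector field. The Euler field [E] and the rotations [L_ij] are
    both of this kind, so brackets and integrations by parts are treated once for all matrices. *)
Definition X B f x : R := \sum_i lin B i x * partial i f x.

Lemma linE B i x : lin B i x = \sum_k x 0 k * B k i.
Proof. by rewrite /lin mxE. Qed.

Lemma S1_lin B i : S1 (lin B i) (fun j _ => B j i).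
Proof.
have -> : lin B i = (fun x => \sum_k x 0 k * B k i) by apply/funext => x; rewrite linE.
apply: S1_eq (S1_sum (index_enum _) (fun k => S1M (@S1_coord R n k) (@S1_cst R n (B k i)))) _.
move=> j x /=; rewrite (bigD1 j)//= big1 ?addr0 ?eqxx ?mul1r ?mulr0 ?addr0//.
by move=> k kj; rewrite eq_sym (negbTE kj) mul0r mulr0 addr0.
Qed.

Lemma T0_X B f : T1 f -> T0 (X B f).
Proof.
move=> Tf; apply: T0_sum => i; under eq_fun do rewrite mulrC.
by apply: T0M; [exact: T1_dT0|have [] := S1_lin B i].
Qed.

Lemma T1_X B f : T2 f -> T1 (X B f) /\ forall j, partial j (X B f) =
  (fun x => \sum_i (B j i * partial i f x + lin B i x * partial j (partial i f) x)).
Proof.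
move=> [_ Tdf].
have H i := T1M (Tdf i) (S1_lin B i).
have E : X B f = (fun x => \sum_i partial i f x * lin B i x).
  by apply/funext => x; apply: eq_bigr => i _; rewrite mulrC.
have [T1s Es] := T1_sum (index_enum _) (fun i => proj1 (H i)).
rewrite E; split=> // j; rewrite Es; apply/funext => x; apply: eq_bigr => i _.
by rewrite (proj2 (H i)); ring.
Qed.

Lemma X_mul B f g dg x : T1 f -> S1 g dg -> X B (fun y => f y * g y) x =
  X B f x * g x + f x * \sum_i lin B i x * dg i x.
Proof.
move=> Tf Sg; rewrite /X mulr_suml mulr_sumr -big_split; apply: eq_bigr => i _ /=.
by rewrite (proj2 (T1M Tf Sg)); ring.
Qed.

Lemma X_add B f g x : T1 f -> T1 g -> X B (fun y => f y + g y) x = X B f x + X B g x.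
Proof.
move=> Tf Tg; rewrite /X -big_split; apply: eq_bigr => i _ /=.
by rewrite (proj2 (T1D Tf Tg)); ring.
Qed.

Lemma X_scale B f c x : T1 f -> X B (fun y => c * f y) x = c * X B f x.
Proof.
move=> Tf; rewrite /X mulr_sumr; apply: eq_bigr => i _ /=.
by rewrite (proj2 (T1Z c Tf)); ring.
Qed.

(** The bracket of two linear fields is the field of the commutator [B *m C - C *m B]: second-order
    terms cancel by [partial_comm], and the rest comes from differentiating the coefficients. *)
Lemma X_comm B C f x : T2 f ->
  X B (X C f) x + X (C *m B) f x = X C (X B f) x + X (B *m C) f x.
Proof.
move=> Tf.
have aux (B' C' : 'M[R]_n) : X B' (X C' f) x = X (B' *m C') f x +
    \sum_j \sum_i lin B' j x * lin C' i x * partial j (partial i f) x.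
  rewrite /X; under eq_bigr => j _.
    rewrite -/(X C' f) (proj2 (T1_X C' Tf)) big_split/= mulrDr; over.
  rewrite big_split/=; congr (_ + _); last first.
    by apply: eq_bigr => j _; rewrite mulr_sumr; apply: eq_bigr => i _; rewrite mulrA.
  under eq_bigr do rewrite mulr_sumr.
  rewrite exchange_big; apply: eq_bigr => i _ /=.
  rewrite /lin mulmxA [(_ *m C') 0 i]mxE mulr_suml.
  by apply: eq_bigr => j _; rewrite mulrA.
have ES : \sum_j \sum_i lin B j x * lin C i x * partial j (partial i f) x =
    \sum_j \sum_i lin C j x * lin B i x * partial j (partial i f) x.
  rewrite exchange_big; apply: eq_bigr => i _; apply: eq_bigr => j _ /=.
  by rewrite (partial_comm i j Tf) [lin B j x * _]mulrC.
by rewrite !aux ES addrAC [RHS]addrAC; congr (_ + _); rewrite addrC.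
Qed.

Definition wt x : R := enorm x `^ (- n%:R).

Definition mu f : R := int (fun x => f x * wt x).

Lemma muE f : mu f = int (fun x => f x * wt x). Proof. by []. Qed.

Lemma S0_wt : S0 wt. Proof. by have [] := @S1_powR R n (- n%:R). Qed.

Lemma T0_wt f : T0 f -> T0 (fun x => f x * wt x).
Proof. by move=> Tf; apply: T0M => //; exact: S0_wt. Qed.

Lemma eq_mu f g : f =1 g -> mu f = mu g. Proof. by move=> /funext ->. Qed.

Lemma muD f g : T0 f -> T0 g -> mu (fun x => f x + g x) = mu f + mu g.
Proof.
move=> Tf Tg; rewrite /mu -(intD (T0_wt Tf) (T0_wt Tg)).
by apply: eq_int => x; rewrite mulrDl.
Qed.

Lemma muZ f (c : R) : T0 f -> mu (fun x => c * f x) = c * mu f.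
Proof.
move=> Tf; rewrite /mu -(intZ _ (T0_wt Tf)).
by apply: eq_int => x; rewrite mulrA.
Qed.

Lemma mu_sum (I : Type) (r : seq I) (F : I -> V -> R) : (forall a, T0 (F a)) ->
  mu (fun x => \sum_(a <- r) F a x) = \sum_(a <- r) mu (F a).
Proof.
move=> TF; rewrite /mu -(int_sum _ (fun a => T0_wt (TF a))).
by apply: eq_int => x; rewrite mulr_suml.
Qed.

Lemma mu_ge0 f : (forall x, 0 <= f x) -> 0 <= mu f.
Proof. by move=> f0; apply: int_ge0 => x; rewrite mulr_ge0// powR_ge0. Qed.

Lemma mu_le f g : T0 f -> T0 g -> (forall x, f x <= g x) -> mu f <= mu g.
Proof.
move=> Tf Tg fg; rewrite -subr_ge0 -mulN1r -(muZ _ Tf) -(muD Tg (T0Z _ Tf)).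
by apply: mu_ge0 => x; rewrite mulN1r subr_ge0.
Qed.

(* The field [x |-> x B] is divergence free with respect to [mu]. *)
Definition mu_invariant B := forall x, n%:R * (\sum_i lin B i x * x 0 i) = \tr B * nsq x.

Definition dwt i x : R := - n%:R * enorm x `^ (- n%:R - 1) * (x 0 i / enorm x).

(** The divergence of [|x|^-n x B] is [|x|^-n] times [tr B - n <x B, x> / |x|^2], which
    [mu_invariant] makes zero. *)
Lemma div_free B x : mu_invariant B -> Om x ->
  \sum_i (B i i * wt x + lin B i x * dwt i x) = 0.
Proof.
move=> gB /andP[x0 _]; rewrite big_split/= -mulr_suml.
under [X in _ + X]eq_bigr => i _.
  rewrite (_ : _ * _ = lin B i x * x 0 i * (- n%:R * enorm x `^ (- n%:R - 1) / enorm x));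
    last by rewrite /dwt; ring.
  over.
rewrite -mulr_suml.
have -> : enorm x `^ (- n%:R - 1) = wt x / enorm x.
  rewrite powRB; last by apply/implyP => _; rewrite gt_eqF.
  by rewrite powRr1// ltW.
have := gB x; rewrite -enorm_sqr; set S := \sum_(i < n) _ => E.
have -> : \sum_i B i i = n%:R * S / enorm x ^+ 2.
  by rewrite E mulfK// expf_neq0// gt_eqF.
by field; rewrite gt_eqF.
Qed.

Lemma S1_linwt B i : S1 (fun x => lin B i x * wt x)
  (fun j x => B j i * wt x + lin B i x * dwt j x).
Proof. exact: (S1M (S1_lin B i) (@S1_powR R n _)). Qed.

Lemma mu_X B f : T1 f -> mu_invariant B -> mu (X B f) = 0.
Proof.
move=> Tf gB.
have H i := T1M Tf (S1_linwt B i).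
have Z : \sum_i int (partial i (fun x => f x * (lin B i x * wt x))) = 0.
  by rewrite big1// => i _; exact: (int_partial i (proj1 (H i))).
rewrite -{}Z -(int_sum (A := A)); last by move=> i; exact: (T1_dT0 i (proj1 (H i))).
apply: eq_int => x.
under [RHS]eq_bigr do rewrite (proj2 (H _)).
rewrite big_split/= -mulr_sumr /X mulr_suml.
have -> : f x * (\sum_i (B i i * wt x + lin B i x * dwt i x)) = 0.
  have [ax|ax] := boolP (annulus A x).
    by rewrite div_free ?mulr0//; exact: annulusW ax.
  by rewrite (proj2 (T1_T0 Tf)) ?mul0r.
by rewrite addr0; apply: eq_bigr => i _; ring.
Qed.

(** The left side has the shape to which [int_partial_sym] applies term by term. In the product
    rule, the derivative of [p] gives [X B p], that of [lin B i * wt] disappears by [div_free], and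
    that of [lin C j] produces [B *m C]. *)
Lemma mu_XX B C p v : T1 p -> T1 v -> mu_invariant B ->
  \sum_i \sum_j int (fun x =>
     partial i (fun y => p y * (lin B i y * wt y * lin C j y)) x * partial j v x) =
  mu (fun x => X B p x * X C v x) + mu (fun x => p x * X (B *m C) v x).
Proof.
move=> Tp Tv gB.
have H i j := T1M Tp (S1M (S1_linwt B i) (S1_lin C j)).
have TF i j : T0 (fun x => partial i (fun y => p y * (lin B i y * wt y * lin C j y)) x
    * partial j v x).
  by apply: T0_mul; [exact: (T1_dT0 i (proj1 (H i j)))|exact: T1_dT0].
rewrite -muD; [|by apply: T0_mul; exact: T0_X|by apply: T0_mul;[exact: T1_T0|exact: T0_X]].
under eq_bigr => i _ do rewrite -(int_sum (A := A))//.
rewrite -(int_sum (A := A)); last by move=> i; apply: T0_sum => j; exact: TF.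
apply: eq_int => x.
under eq_bigr => i _ do under eq_bigr => j _ do rewrite (proj2 (H _ _)).
rewrite exchange_big/=.
have -> : (X B p x * X C v x + p x * X (B *m C) v x) * wt x =
    \sum_j (X B p x * wt x * lin C j x + p x * wt x * lin (B *m C) j x) * partial j v x.
  transitivity (X B p x * wt x * X C v x + p x * wt x * X (B *m C) v x); first by ring.
  rewrite [X C v x]/X [X (B *m C) v x]/X !mulr_sumr -big_split; apply: eq_bigr => j _ /=.
  by ring.
apply: eq_bigr => j _; rewrite -mulr_suml; congr (_ * _).
rewrite big_split/= -mulr_sumr; congr (_ + _).
  by rewrite /X !mulr_suml; apply: eq_bigr => i _; ring.
rewrite -mulrA; have [ax|ax] := boolP (annulus A x); last first.
  by rewrite (proj2 (T1_T0 Tp)) ?mul0r.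
congr (_ * _); rewrite big_split/= -mulr_suml div_free ?mul0r ?add0r//; last first.
  exact: annulusW ax.
rewrite /lin mulmxA [in RHS]mxE mulr_sumr; apply: eq_bigr => i _; by rewrite mulrAC mulrC mulrA.
Qed.

(** For smoother [v] this would follow from [mu (X B p * X C v) = - mu (p * X B (X C v))] and the
    bracket formula; in this form it only involves first derivatives. *)
Lemma mu_X_swap B C p v : T1 p -> T1 v -> mu_invariant B -> mu_invariant C ->
  mu (fun x => X B p x * X C v x) + mu (fun x => p x * X (B *m C) v x) =
  mu (fun x => X C p x * X B v x) + mu (fun x => p x * X (C *m B) v x).
Proof.
move=> Tp Tv gB gC; rewrite -!mu_XX// [RHS]exchange_big/=.
apply: eq_bigr => i _; apply: eq_bigr => j _.
have T := proj1 (T1M Tp (S1M (S1_linwt B i) (S1_lin C j))).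
rewrite (int_partial_sym i j T Tv).
have -> // : (fun y => p y * (lin C j y * wt y * lin B i y)) =
  (fun y => p y * (lin B i y * wt y * lin C j y)).
by apply/funext => y; ring.
Qed.

End Fields.

(** * Rotation fields, the Euler field and the Casimir identity *)

Section Angular.
Variables (R : realType) (n : nat) (A : radii R).
Local Notation V := 'rV[R]_n.
Local Notation e_ := (@ebasis R n).
Local Notation T0 := (@T0 R n A).
Local Notation T1 := (@T1 R n A).
Local Notation T2 := (@T2 R n A).
Local Notation mu := (@mu R n).
Implicit Types (f g p v w : V -> R) (x y : V) (i j k l : 'I_n) (B C : 'M[R]_n).

Lemma mu_invariant_antisym B : B^T = - B -> mu_invariant B.
Proof.
move=> BT x.
have -> : \tr B = 0.
  have : \tr B^T = \tr B by rewrite mxtrace_tr.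
  rewrite BT raddfN => h; lra.
have -> : \sum_i lin B i x * x 0 i = (x *m B *m x^T) 0 0.
  by rewrite mxE; apply: eq_bigr => i _; rewrite [x^T _ _]mxE.
have : ((x *m B *m x^T)^T) 0 0 = - (x *m B *m x^T) 0 0.
  by rewrite !trmx_mul trmxK BT mulNmx mulmxN mulmxA !mxE.
rewrite mxE => h; have -> : (x *m B *m x^T) 0 0 = 0 by lra.
by rewrite mulr0 mul0r.
Qed.

Lemma mu_invariant1 : mu_invariant (1%:M : 'M[R]_n).
Proof.
move=> x; rewrite mxtrace1; congr (_ * _).
by apply: eq_bigr => i _; rewrite /lin mulmx1 expr2.
Qed.

Lemma mu_ibp B f g : T1 f -> T1 g -> mu_invariant B ->
  mu (fun x => f x * X B g x) = - mu (fun x => X B f x * g x).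
Proof.
move=> Tf Tg gB; have [Tfg _] := T1_mul Tf Tg.
have E : X B (fun x => f x * g x) =1 (fun x => X B f x * g x + f x * X B g x).
  by move=> x; rewrite (X_mul _ _ Tf (T1_S1 Tg)).
have := mu_X Tfg gB; rewrite (eq_mu E) (muD (T0_mul (T0_X B Tf) (T1_T0 Tg)) (T0_mul (T1_T0 Tf) (T0_X B Tg))).
by move=> h; apply/eqP; rewrite -addr_eq0 addrC h.
Qed.

Definition rotmx i j : 'M[R]_n := delta_mx i j - delta_mx j i.
Definition La i j := X (rotmx i j).
Definition Eul := X (1%:M : 'M[R]_n).

Lemma rotmx_antisym i j : (rotmx i j)^T = - rotmx i j.
Proof. by rewrite /rotmx linearB/= !trmx_delta opprB. Qed.

Lemma mu_invariant_rotmx i j : mu_invariant (rotmx i j).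
Proof. by apply: mu_invariant_antisym; exact: rotmx_antisym. Qed.

Lemma lin_rotmx i j k x : lin (rotmx i j) k x = x 0 i * (k == j)%:R - x 0 j * (k == i)%:R.
Proof.
rewrite /lin /rotmx mulmxBr 2!mxE [in X in _ + X]mxE !mxE.
rewrite (bigD1 i)//= [in X in _ - X](bigD1 j)//= !mxE !eqxx/= !big1 ?addr0//.
- by move=> l lj; rewrite mxE (negbTE lj) mulr0.
- by move=> l lj; rewrite mxE (negbTE lj) mulr0.
Qed.

Lemma sum_delta j (F : 'I_n -> R) : \sum_k (k == j)%:R * F k = F j.
Proof.
rewrite (bigD1 j)//= eqxx mul1r big1 ?addr0// => k kj.
by rewrite (negbTE kj) mul0r.
Qed.

Lemma sum_lin_rotmx i j x (F : 'I_n -> R) :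
  \sum_k lin (rotmx i j) k x * F k = x 0 i * F j - x 0 j * F i.
Proof.
under eq_bigr do rewrite lin_rotmx mulrBl -!mulrA.
by rewrite big_split/= sumrN -!mulr_sumr !sum_delta.
Qed.

Lemma LaE i j f x : La i j f x = x 0 i * partial j f x - x 0 j * partial i f x.
Proof. exact: sum_lin_rotmx. Qed.

Lemma EulE f x : Eul f x = \sum_i x 0 i * partial i f x.
Proof. by apply: eq_bigr => i _; rewrite /lin mulmx1. Qed.

Definition dot (a b : 'I_n -> R) := \sum_k a k * b k.

Lemma dotC a b : dot a b = dot b a.
Proof. by apply: eq_bigr => k _; rewrite mulrC. Qed.

(** The factor 2 appears because the sum runs over ordered pairs. *)
Lemma Binet_Cauchy (p q r s : 'I_n -> R) :
  \sum_k \sum_l (p k * q l - p l * q k) * (r k * s l - r l * s k) =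
  2 * (dot p r * dot q s - dot p s * dot q r).
Proof.
have D (a b c d : 'I_n -> R) :
    \sum_k \sum_l a k * b l * (c k * d l) = dot a c * dot b d.
  rewrite /dot big_distrl/=; apply: eq_bigr => k _.
  by rewrite big_distrr/=; apply: eq_bigr => l _; ring.
transitivity (\sum_k \sum_l p k * q l * (r k * s l) + \sum_k \sum_l q k * p l * (s k * r l)
   - (\sum_k \sum_l p k * q l * (s k * r l) + \sum_k \sum_l q k * p l * (r k * s l))).
  rewrite -!big_split -sumrB/=; apply: eq_bigr => k _.
  rewrite -!big_split -sumrB/=; apply: eq_bigr => l _; ring.
by rewrite !D; ring.
Qed.

(* This is the invariance of the Casimir element [sum_kl L_kl (x) L_kl] under [ad B]. *)
Lemma casimir_invariant B w v x : B^T = - B ->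
  \sum_k \sum_l ((X (B *m rotmx k l) w x - X (rotmx k l *m B) w x) * La k l v x +
    La k l w x * (X (B *m rotmx k l) v x - X (rotmx k l *m B) v x)) = 0.
Proof.
move=> BT.
pose g i := partial i w x; pose h i := partial i v x; pose y := lin B ^~ x.
pose ax i : R := x 0 i.
pose G (a : 'I_n -> R) l := \sum_i B l i * a i.
have Bij i j : B i j = - B j i by have := congr1 (fun M : 'M[R]_n => M j i) BT; rewrite !mxE.
have E1 k l f : X (B *m rotmx k l) f x = y k * partial l f x - y l * partial k f x.
  by rewrite /X /lin; under eq_bigr do rewrite mulmxA; exact: sum_lin_rotmx.
have E2 k l f : X (rotmx k l *m B) f x =
    ax k * G (fun i => partial i f x) l - ax l * G (fun i => partial i f x) k.
  rewrite /X /G !mulr_sumr -sumrB; apply: eq_bigr => i _.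
  rewrite {1}/lin mulmxA mxE.
  rewrite [X in X * _](sum_lin_rotmx k l x (fun j => B j i)).
  by rewrite -/(ax k) -/(ax l); ring.
under eq_bigr => k _ do under eq_bigr => l _ do rewrite !E1 !E2 !LaE.
rewrite -/g -/h.
(* Each of these four double sums is evaluated by [Binet_Cauchy]. Antisymmetry of [B] then enters
   through three facts on dot products: [yG] moves [B] across, [yx] says that [x B] is orthogonal to
   [x], and [GG] that [B] is skew. *)
transitivity (
  \sum_k \sum_l (y k * g l - y l * g k) * (ax k * h l - ax l * h k)
  - \sum_k \sum_l (ax k * G g l - ax l * G g k) * (ax k * h l - ax l * h k)
  + \sum_k \sum_l (y k * h l - y l * h k) * (ax k * g l - ax l * g k)
  - \sum_k \sum_l (ax k * G h l - ax l * G h k) * (ax k * g l - ax l * g k)).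
  rewrite -!sumrB -!big_split -!sumrB/=; apply: eq_bigr => k _.
  rewrite -!sumrB -!big_split -!sumrB/=; apply: eq_bigr => l _.
  rewrite /g /h /ax; move: (x 0 k) (x 0 l) (y k) (y l).
  move: (partial k w x) (partial l w x) (partial k v x) (partial l v x).
  by move: (G _ k) (G _ l) (G _ k) (G _ l) => *; ring.
have yG (a : 'I_n -> R) : dot y a = dot ax (G a).
  rewrite /dot /y; under eq_bigr do rewrite linE mulr_suml.
  rewrite exchange_big; apply: eq_bigr => i _ /=.
  by rewrite /G mulr_sumr; apply: eq_bigr => k _; rewrite mulrA.
have yx : dot y ax = 0.
  suff : dot y ax = - dot y ax by move=> ?; lra.
  rewrite {1}yG /dot -sumrN; apply: eq_bigr => k _.
  rewrite /y linE -mulNr -sumrN [RHS]mulrC; congr (_ * _).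
  by apply: eq_bigr => i _; rewrite Bij mulrC mulrN.
have GG : dot (G g) h = - dot (G h) g.
  rewrite /dot /G; under eq_bigr do rewrite mulr_suml.
  rewrite exchange_big -sumrN; apply: eq_bigr => i _ /=.
  rewrite mulr_suml -sumrN; apply: eq_bigr => k _; rewrite [B k i]Bij; ring.
rewrite !Binet_Cauchy yx GG !yG [dot (G h) ax]dotC [dot (G g) ax]dotC.
rewrite [dot g ax]dotC [dot h ax]dotC [dot h g]dotC; ring.
Qed.

End Angular.

(** * The angular inequality *)

Section Poincare.
Variables (R : realType) (n : nat) (A : radii R).
Local Notation V := 'rV[R]_n.
Local Notation e_ := (@ebasis R n).
Local Notation T0 := (@T0 R n A).
Local Notation T1 := (@T1 R n A).
Local Notation T2 := (@T2 R n A).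
Local Notation mu := (@mu R n).
Implicit Types (f g p v w : V -> R) (x y : V) (i j k l : 'I_n) (B C : 'M[R]_n).

(* [Lsq] and [Lam] are twice the angular energy density [|L f|^2] and the spherical
   Laplacian [Lambda f]: every unordered pair [{k, l}] is counted twice. *)
Definition Lsq f x := \sum_k \sum_l La k l f x ^+ 2.
Definition Lam f x := \sum_k \sum_l La k l (La k l f) x.

Lemma T0_sqr f : T0 f -> T0 (fun x => f x ^+ 2).
Proof. by move=> Tf; exact: (T0_mul Tf Tf). Qed.

Lemma T0_sub f g : T0 f -> T0 g -> T0 (fun x => f x - g x).
Proof.
move=> Tf Tg; have := T0D Tf (T0Z (-1) Tg).
by under eq_fun do rewrite mulN1r.
Qed.

Lemma muB f g : T0 f -> T0 g -> mu (fun x => f x - g x) = mu f - mu g.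
Proof.
move=> Tf Tg; rewrite -mulN1r -(muZ _ Tg) -(muD Tf (T0Z _ Tg)).
by apply: eq_mu => x; rewrite mulN1r.
Qed.

Lemma T0_Lsq f : T1 f -> T0 (Lsq f).
Proof.
by move=> Tf; apply: T0_sum => k; apply: T0_sum => l; apply: T0_sqr; exact: T0_X.
Qed.

Lemma T1_La k l f : T2 f -> T1 (La k l f).
Proof. by move=> Tf; have [] := T1_X (rotmx R k l) Tf. Qed.

Lemma T0_La k l f : T1 f -> T0 (La k l f).
Proof. exact: T0_X. Qed.

Lemma T0_Lam f : T2 f -> T0 (Lam f).
Proof.
by move=> Tf; apply: T0_sum => k; apply: T0_sum => l; apply: T0_X; exact: T1_La.
Qed.

Lemma mu_sum2 (F : 'I_n -> 'I_n -> V -> R) : (forall k l, T0 (F k l)) ->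
  mu (fun x => \sum_k \sum_l F k l x) = \sum_k \sum_l mu (F k l).
Proof.
move=> TF; rewrite (mu_sum (A := A)); last by move=> k; apply: T0_sum.
by apply: eq_bigr => k _; rewrite (mu_sum (A := A)).
Qed.

Lemma mu_Lsq f : T1 f -> mu (Lsq f) = \sum_k \sum_l mu (fun x => La k l f x ^+ 2).
Proof. by move=> Tf; rewrite /Lsq mu_sum2// => k l; apply: T0_sqr; exact: T0_X. Qed.

Lemma mu_Lam_green w : T2 w -> mu (fun x => w x * Lam w x) = - mu (Lsq w).
Proof.
move=> Tw; have [Tw1 _] := Tw; rewrite mu_Lsq// -sumrN.
transitivity (mu (fun x => \sum_k \sum_l w x * La k l (La k l w) x)).
  apply: eq_mu => x; rewrite /Lam mulr_sumr; apply: eq_bigr => k _.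
  by rewrite mulr_sumr.
rewrite mu_sum2; last first.
  by move=> k l; apply: T0_mul; [exact: T1_T0|apply: T0_X; exact: T1_La].
apply: eq_bigr => k _; rewrite -sumrN; apply: eq_bigr => l _.
exact: (mu_ibp Tw1 (T1_La k l Tw) (@mu_invariant_rotmx R n k l)).
Qed.

(* The weak form of [Lam (X B w) = X B (Lam w)], without third derivatives. *)
Lemma mu_Lam_X B w v : B^T = - B -> T2 w -> T1 v ->
  mu (fun x => Lam w x * X B v x) =
  \sum_k \sum_l mu (fun x => La k l (X B w) x * La k l v x).
Proof.
move=> BT Tw Tv; have [Tw1 _] := Tw; have gB := mu_invariant_antisym BT.
have TBw := proj1 (T1_X B Tw).
(* [D k l] collects the brackets of [X B] with [La k l]. The terms need not vanish one by one, but
   their sum over [k] and [l] does, by [casimir_invariant]. *)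
pose D k l x := (X (B *m rotmx R k l) w x - X (rotmx R k l *m B) w x) * La k l v x +
  La k l w x * (X (B *m rotmx R k l) v x - X (rotmx R k l *m B) v x).
have TD k l : T0 (D k l).
  by apply: T0D; apply: T0_mul; try apply: T0_sub; exact: T0_X.
have key k l : mu (fun x => La k l (La k l w) x * X B v x) =
    mu (fun x => La k l (X B w) x * La k l v x) + mu (D k l).
  have Tp := T1_La k l Tw.
  (* With [p = La k l w], the two fields are exchanged in a single step, so [La k l w] is
     differentiated only once. *)
  have S := mu_X_swap Tp Tv (@mu_invariant_rotmx R n k l) gB.
  have E x : X B (La k l w) x * La k l v x =
      La k l (X B w) x * La k l v x
      + (X (B *m rotmx R k l) w x - X (rotmx R k l *m B) w x) * La k l v x.
    have C := X_comm B (rotmx R k l) x Tw.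
    have -> : X B (La k l w) x =
      La k l (X B w) x + X (B *m rotmx R k l) w x - X (rotmx R k l *m B) w x.
      by apply/eqP; rewrite eq_sym subr_eq eq_sym; apply/eqP.
    by rewrite -mulrDl addrA.
  rewrite (eq_mu E) in S.
  have t1 : T0 (fun x => La k l (X B w) x * La k l v x) by apply: T0_mul; exact: T0_X.
  have t2 : T0 (fun x => (X (B *m rotmx R k l) w x - X (rotmx R k l *m B) w x) * La k l v x).
    by apply: T0_mul; [apply: T0_sub|]; exact: T0_X.
  have t3 C : T0 (fun x => La k l w x * X C v x).
    by apply: T0_mul; exact: T0_X.
  have t4 : T0 (fun x => La k l w x * (X (B *m rotmx R k l) v x - X (rotmx R k l *m B) v x)).
    by apply: T0_mul; [|apply: T0_sub]; exact: T0_X.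
  have E4 : mu (fun x => La k l w x * (X (B *m rotmx R k l) v x - X (rotmx R k l *m B) v x)) =
     mu (fun x => La k l w x * X (B *m rotmx R k l) v x) -
     mu (fun x => La k l w x * X (rotmx R k l *m B) v x).
    by rewrite -(muB (t3 _) (t3 _)); apply: eq_mu => x; rewrite mulrBr.
  rewrite (muD t1 t2) in S; rewrite /D (muD t2 t4) E4.
  move: S; rewrite -!/(La _ _).
  move: (mu _) (mu _) (mu _) (mu _) (mu _) => a b c d e S; lra.
transitivity (mu (fun x => \sum_k \sum_l La k l (La k l w) x * X B v x)).
  apply: eq_mu => x; rewrite /Lam mulr_suml; apply: eq_bigr => k _.
  by rewrite mulr_suml.
rewrite mu_sum2; last first.
  by move=> k l; exact: (T0_mul (T0_La k l (T1_La k l Tw)) (T0_X B Tv)).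
under eq_bigr => k _ do (under eq_bigr => l _ do rewrite key; rewrite big_split/=).
rewrite big_split/= -(mu_sum2 TD).
rewrite (_ : (fun x => \sum_k \sum_l D k l x) = (fun x => 0 * 0)); last first.
  by apply/funext => x; rewrite mul0r; exact: casimir_invariant.
by rewrite (muZ _ (@T0_cst0 R n A)) mul0r addr0.
Qed.

Lemma mu_Lam_La i j w : T2 w ->
  mu (fun x => Lam w x * La i j (La i j w) x) = mu (Lsq (La i j w)).
Proof.
move=> Tw; rewrite (mu_Lsq (T1_La i j Tw)).
exact: (mu_Lam_X (rotmx_antisym R i j) Tw (T1_La i j Tw)).
Qed.

(** One factor [Lam w] is expanded into the [La i j (La i j w)]. Since [Lam] commutes with
    rotations, each term becomes the angular energy of [La i j w], to which a ground state bound can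
    be applied. *)
Lemma mu_Lam_sqr w : T2 w ->
  mu (fun x => Lam w x ^+ 2) = \sum_i \sum_j mu (Lsq (La i j w)).
Proof.
move=> Tw; have H i j : T0 (fun x => Lam w x * La i j (La i j w) x).
  exact: (T0_mul (T0_Lam Tw) (T0_La i j (T1_La i j Tw))).
transitivity (\sum_i \sum_j mu (fun x => Lam w x * La i j (La i j w) x)).
  rewrite -(mu_sum2 H); apply: eq_mu => x.
  rewrite expr2 {2}/Lam mulr_sumr; apply: eq_bigr => i _; exact: mulr_sumr.
by apply: eq_bigr => i _; apply: eq_bigr => j _; exact: mu_Lam_La.
Qed.

End Poincare.

(** * The ground state inequality for functions vanishing on a coordinate hyperplane *)

Section GroundState.
Variables (R : realType) (n : nat) (A : radii R).
Local Notation V := 'rV[R]_n.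
Local Notation e_ := (@ebasis R n).
Local Notation T0 := (@T0 R n A).
Local Notation T1 := (@T1 R n A).
Local Notation T2 := (@T2 R n A).
Local Notation mu := (@mu R n).
Implicit Types (f g p v w : V -> R) (x y : V) (i j k l : 'I_n).

(** On the annulus the weight is at most [rho1 ^ -n], and the annulus lies in a box of volume
    [2 ^ n]. *)
Lemma mu_bound : exists2 W : R, 0 <= W & forall f (c : R), T0 f -> 0 <= c ->
  (forall x, `|f x| <= c) -> `|mu f| <= c * W.
Proof.
exists ((rho1 A) ^- n * (2 * 1) ^+ n).
  by rewrite mulr_ge0// ?invr_ge0 exprn_ge0// ?mulr_ge0// ltW// rho1_gt0.
move=> f c Tf c0 fc; rewrite mulrA.
have r0 := rho1_gt0 A.
apply: (int_bound (M := 1)) => //.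
- by rewrite mulr_ge0// invr_ge0 exprn_ge0// ltW.
- exact: T0_UB (T0_wt Tf).
move=> x; have [ax|ax] := boolP (annulus A x); last first.
  by rewrite (proj2 Tf) ?mul0r ?normr0// mulr_ge0// invr_ge0 exprn_ge0// ltW.
rewrite normrM ler_pM//; move: ax => /andP[ax _].
rewrite ger0_norm ?powR_ge0// /wt powR_invn ?enorm_ge0//.
by rewrite lef_pV2 ?posrE ?exprn_gt0 ?lerXn2r ?nnegrE ?enorm_ge0// ?(lt_le_trans r0)// ltW.
Qed.

Lemma S1_inv g dg : S1 g dg -> (forall x, Om x -> g x != 0) ->
  S1 (fun x : V => (g x)^-1) (fun i x => - (g x) ^- 2 * dg i x).
Proof.
move=> Sg g0; apply: (@S1_comp _ _ (@GRing.inv R) (fun t => - t ^- 2) g dg Sg).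
- move=> x /g0 gx; have := @is_deriveV R id (g x) 1 1 gx (is_derive_id _ _).
  by move=> h; apply: is_derive_eq h _; rewrite [_ *: 1]mulr1.
- move=> x /g0 gx; apply: cvgN; apply: cvgV; first by rewrite expf_neq0.
  exact: exprn_continuous.
Qed.

Section Regularization.
Variables (k : 'I_n) (eps : R).
Hypotheses (eps_gt0 : 0 < eps) (eps_le1 : eps <= 1).

Definition smod x : R := Num.sqrt (x 0 k ^+ 2 + eps ^+ 4).
(* [q = phi' / phi] and [psi = phi'' / phi] at [x_k], for
   [phi t = eps + sqrt (t ^ 2 + eps ^ 4)], a smoothing of the ground state [|t|] for which
   [t ^ 2 * (1 - t * q)] and [t ^ 2 * psi] are O(eps) uniformly on [-1, 1]. *)
Definition qreg x : R := x 0 k / smod x / (eps + smod x).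
Definition psireg x : R := eps ^+ 4 / smod x ^+ 3 / (eps + smod x).

Lemma smod_sqr x : smod x ^+ 2 = x 0 k ^+ 2 + eps ^+ 4.
Proof. by rewrite sqr_sqrtr// addr_ge0 ?sqr_ge0// exprn_ge0// ltW. Qed.

Lemma smod_ge x : eps ^+ 2 <= smod x.
Proof.
rewrite -(ler_pXn2r (n := 2)) ?nnegrE ?sqrtr_ge0 ?sqr_ge0//.
by rewrite smod_sqr -exprM -[(2 * 2)%N]/4%N lerDr sqr_ge0.
Qed.

Lemma smod_gt0 x : 0 < smod x.
Proof. by apply: lt_le_trans (smod_ge x); rewrite exprn_gt0. Qed.

Lemma S1_smod : S1 smod (fun i x => x 0 k / smod x * (i == k)%:R).
Proof.
have S : S1 (fun x : V => x 0 k ^+ 2 + eps ^+ 4) (fun i x => 2 * x 0 k * (i == k)%:R).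
  apply: S1_eq; first exact: (S1D (S1M (@S1_coord R n k) (@S1_coord R n k)) (@S1_cst R n (eps ^+ 4))).
  by move=> i x /=; ring.
have pos x : 0 < x 0 k ^+ 2 + eps ^+ 4 by rewrite ltr_wpDl ?sqr_ge0// exprn_gt0.
apply: S1_eq; first apply: (@S1_comp R n Num.sqrt (fun t => (2 * Num.sqrt t)^-1) _ _ S).
- by move=> x _; exact: is_derive1_sqrt.
- move=> x _; apply: continuousV1.
    by apply: cvgM; [exact: cvg_cst|exact: sqrt_continuous].
  by rewrite mulf_neq0// gt_eqF// sqrtr_gt0.
- move=> i x /=; rewrite -/(smod x); have := smod_gt0 x; move: (smod x) => s s0.
  by field; rewrite gt_eqF.
Qed.

(** The Riccati equation [q' = phi'' / phi - q ^ 2] of a logarithmic derivative. *)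
Lemma S1_qreg : S1 qreg (fun i x => (psireg x - qreg x ^+ 2) * (i == k)%:R).
Proof.
apply: S1_eq; first apply: (S1M (S1M (@S1_coord R n k) (S1_inv S1_smod _))
  (S1_inv (S1D (@S1_cst R n eps) S1_smod) _)).
- by move=> x _; rewrite gt_eqF// smod_gt0.
- by move=> x _; rewrite gt_eqF// addr_gt0// smod_gt0.
move=> i x /=; rewrite /psireg /qreg.
have := smod_gt0 x; have := smod_sqr x; move: (smod x) (x 0 k) => s t E s0.
have -> : eps ^+ 4 = s ^+ 2 - t ^+ 2 by rewrite E addrC addKr.
by field; rewrite !gt_eqF// addr_gt0.
Qed.

Lemma qreg_err x : 0 <= 1 - x 0 k * qreg x.
Proof.
rewrite /qreg; have := smod_gt0 x; have := smod_sqr x; move: (smod x) (x 0 k) => s t E s0.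
have p : 0 < s * (eps + s) by rewrite mulr_gt0// addr_gt0.
rewrite (_ : 1 - _ = (s * eps + eps ^+ 4) / (s * (eps + s))).
  by rewrite divr_ge0// ?ltW// addr_gt0// ?mulr_gt0// exprn_gt0.
have -> : eps ^+ 4 = s ^+ 2 - t ^+ 2 by rewrite E addrC addKr.
by field; rewrite !gt_eqF// addr_gt0.
Qed.

(** With [t = x 0 k] and [s = smod x], the left side is [t^2 (s eps + eps^4) / (s (eps + s))]. The
    bounds [t^2 <= s^2], [eps^4 <= s eps] and [s <= 2] give the constant 4. *)
Lemma qreg_err_le x : `|x 0 k| <= 1 -> x 0 k ^+ 2 * (1 - x 0 k * qreg x) <= 4 * eps.
Proof.
move=> x1; have x2 : x 0 k ^+ 2 <= 1 by rewrite -real_normK ?num_real// expr_le1.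
move: x2; rewrite /qreg; have := smod_ge x; have := smod_gt0 x; have := smod_sqr x.
move: (smod x) (x 0 k) => s t E s0 se x2.
have p : 0 < s * (eps + s) by rewrite mulr_gt0// addr_gt0.
rewrite (_ : 1 - _ = (s * eps + eps ^+ 4) / (s * (eps + s))); last first.
  have -> : eps ^+ 4 = s ^+ 2 - t ^+ 2 by rewrite E addrC addKr.
  by field; rewrite !gt_eqF// addr_gt0.
rewrite mulrA ler_pdivrMr//.
have e4 : eps ^+ 4 <= s * eps.
  rewrite (_ : 4 = 2 + 2)%N// exprD; apply: ler_pM; rewrite ?sqr_ge0//.
  by rewrite expr2 ler_piMr// ltW.
have s2 : s ^+ 2 <= 2.
  rewrite E; have : eps ^+ 4 <= 1 by rewrite exprn_ile1// ltW.
  by lra.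
have s3 : s <= 2 by nra.
have ts : t ^+ 2 <= s ^+ 2 by rewrite E lerDl exprn_ge0// ltW.
apply: (@le_trans _ _ (s ^+ 2 * (2 * (s * eps)))).
  apply: ler_pM => //; [by rewrite sqr_ge0|by rewrite addr_ge0 ?mulr_ge0 ?exprn_ge0// ltW|].
  by rewrite mulr_natl mulr2n lerD.
rewrite (_ : s ^+ 2 * _ = s * eps * (2 * (s * s))); last by ring.
rewrite (_ : 4 * eps * _ = s * eps * (4 * (eps + s))); last by ring.
apply: ler_wpM2l; first by rewrite mulr_ge0// ltW.
have : s * s <= s * 2 by rewrite ler_wpM2l// ltW.
by move: eps_gt0; lra.
Qed.

Lemma psireg_ge0 x : 0 <= psireg x.
Proof.
rewrite /psireg; have s0 := smod_gt0 x.
by rewrite !divr_ge0// ?exprn_ge0 ?addr_ge0// ltW.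
Qed.

Lemma psireg_le x : x 0 k ^+ 2 * psireg x <= eps.
Proof.
rewrite /psireg; have := smod_ge x; have := smod_gt0 x; have := smod_sqr x.
move: (smod x) (x 0 k) => s t E s0 se.
have p : 0 < s ^+ 3 * (eps + s) by rewrite mulr_gt0 ?exprn_gt0// addr_gt0.
rewrite (_ : _ * _ = t ^+ 2 * eps ^+ 4 / (s ^+ 3 * (eps + s))); last first.
  by field; rewrite !gt_eqF// addr_gt0.
rewrite ler_pdivrMr//.
have ts : t ^+ 2 <= s ^+ 2 by rewrite E lerDl exprn_ge0// ltW.
apply: (@le_trans _ _ (s ^+ 2 * (eps ^+ 2 * s))).
  apply: ler_pM; rewrite ?sqr_ge0// ?exprn_ge0//; first exact: ltW.
  by rewrite (_ : 4 = 2 + 2)%N// exprD ler_pM2l// exprn_gt0.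
rewrite (_ : s ^+ 2 * _ = eps * (s ^+ 3 * eps)); last by ring.
by rewrite ler_pM2l// ler_pM2l ?exprn_gt0// lerDl ltW.
Qed.

End Regularization.

Lemma S0_qreg k eps : 0 < eps -> S0 (qreg k eps).
Proof. by move=> e0; have [] := S1_qreg k e0. Qed.

Lemma S0_psireg k eps : 0 < eps -> S0 (psireg k eps).
Proof.
move=> e0; have [S dS _] := S1_qreg k e0.
have E : psireg k eps = (fun x => (psireg k eps x - qreg k eps x ^+ 2) * (k == k)%:R +
    qreg k eps x * qreg k eps x) by apply/funext => x; rewrite eqxx mulr1 expr2 subrK.
rewrite E; exact: (S0D (dS k) (S0M S S)).
Qed.

(** Ground state substitution: [La i k phi / phi = q * x_i]. Completing the square with
    [v * q * x_i] leaves a total derivative [La i k (v^2 q x_i)], of integral zero, and a potential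
    that the Riccati equation frees of [q ^ 2]. *)
Lemma mu_La_lower v k i eps : T1 v -> 0 < eps -> i != k ->
  mu (fun x => v x ^+ 2 * (x 0 k * qreg k eps x - psireg k eps x * x 0 i ^+ 2)) <=
  mu (fun x => La i k v x ^+ 2).
Proof.
move=> Tv e0 ik; pose q := qreg k eps; pose psi := psireg k eps.
have Sg := S1M (S1_qreg k e0) (@S1_coord R n i); rewrite -/q -/psi in Sg.
have [TF EF] := T1_mul Tv Tv; have [TFg _] := T1M TF Sg.
have Z := mu_X TFg (@mu_invariant_rotmx R n i k).
have S0q : S0 (fun x => q x * x 0 i) by have [] := Sg.
have TL : T0 (La i k v) by exact: T0_X.
have T0v := T1_T0 Tv.
have Tsq : T0 (fun x => (La i k v x - v x * (q x * x 0 i)) ^+ 2).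
  by apply: T0_sqr; apply: T0_sub => //; exact: T0M.
have TXF := T0_X (rotmx R i k) TFg.
have TG : T0 (fun x => v x ^+ 2 * (x 0 k * q x - psi x * x 0 i ^+ 2)).
  apply: T0M; first exact: T0_sqr.
  have -> : (fun x => x 0 k * q x - psi x * x 0 i ^+ 2) =
      (fun x => x 0 k * q x + (-1 * psi x) * (x 0 i * x 0 i)).
    by apply/funext => x; ring.
  apply: S0D; first by apply: S0M; [exact: S0_coord|exact: S0_qreg].
  by apply: S0M; apply: S0M; rewrite ?/psi; first [exact: S0_cst|exact: S0_psireg|exact: S0_coord].
have E x : La i k v x ^+ 2 = (La i k v x - v x * (q x * x 0 i)) ^+ 2 +
    (X (rotmx R i k) (fun y => v y * v y * (q y * y 0 i)) x +
     v x ^+ 2 * (x 0 k * q x - psi x * x 0 i ^+ 2)).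
  rewrite (X_mul _ _ TF Sg) (X_mul _ _ Tv (T1_S1 Tv)) -/(X _ v x) -/(La i k v x).
  rewrite sum_lin_rotmx eqxx [k == i]eq_sym (negbTE ik) eqxx/=.
  move: (La i k v x) (v x) (q x) (psi x) (x 0 i) (x 0 k) => *; ring.
rewrite [leRHS](eq_mu E) (muD Tsq (T0D TXF TG)) (muD TXF TG) Z add0r lerDr.
by apply: mu_ge0 => x; exact: sqr_ge0.
Qed.

(** Only the pairs containing [k] are kept, in both orders. *)
Lemma Lsq_ge v k x : 2 * \sum_(i | i != k) La i k v x ^+ 2 <= Lsq v x.
Proof.
rewrite mulr_natl mulr2n /Lsq [leRHS](bigD1 k)//=; apply: lerD.
  rewrite [leRHS](bigD1 k)//= ler_wpDl ?sqr_ge0//.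
  by apply: ler_sum => i _; rewrite !LaE -sqrrN opprB.
apply: ler_sum => i ik; rewrite [leRHS](bigD1 k)//= lerDl.
by apply: sumr_ge0 => j _; exact: sqr_ge0.
Qed.

Lemma sum_neq k x : \sum_(i | i != k) x 0 i ^+ 2 = nsq x - x 0 k ^+ 2.
Proof. by rewrite /nsq [in RHS](bigD1 k)//= addrAC subrr add0r. Qed.

Lemma annulus_nsq x : annulus A x -> nsq x <= 1.
Proof.
move=> /annulusW/andP[_ /ltW x1]; rewrite -enorm_sqr expr_le1//; exact: enorm_ge0.
Qed.

(** Summed over [i != k], the potentials of [mu_La_lower] tend to [n - 1] away from [x_k = 0] as
    [eps -> 0]. The linear vanishing of [v] provides the factor [x_k ^ 2] that makes the error
    O(eps) uniformly. *)
Lemma ground_state v k (C : R) : T1 v -> (forall x, `|v x| <= C * `|x 0 k|) ->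
  2 * (n%:R - 1) * mu (fun x => v x ^+ 2) <= mu (Lsq v).
Proof.
move=> Tv vC; have [W W0 HW] := mu_bound.
have n1 : 0 <= n%:R - 1 :> R by rewrite subr_ge0 ler1n (leq_ltn_trans _ (ltn_ord k)).
have T0v := T1_T0 Tv; have Tv2 := T0_sqr T0v.
(* The 4 comes from [qreg_err_le], with weight [n - 1]; the 1 comes from [psireg_le], the sum of the
   [x_i ^ 2] being at most 1 on the annulus. *)
pose K := C ^+ 2 * ((n%:R - 1) * 4 + 1).
have K0 : 0 <= K by rewrite mulr_ge0 ?sqr_ge0// addr_ge0// mulr_ge0.
rewrite -subr_le0; apply: (@le_all_eps _ _ (2 * (K * W))).
  by rewrite mulr_ge0// mulr_ge0.
move=> e e0; pose eps := Num.min e 1.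
have eps0 : 0 < eps by rewrite lt_min e0/=.
have eps1 : eps <= 1 by rewrite ge_min lexx orbT.
have epse : eps <= e by rewrite ge_min lexx.
pose G i x := v x ^+ 2 * (x 0 k * qreg k eps x - psireg k eps x * x 0 i ^+ 2).
have TG i : T0 (G i).
  apply: T0M => //.
  have -> : (fun x : V => x 0 k * qreg k eps x - psireg k eps x * x 0 i ^+ 2) =
      (fun x => x 0 k * qreg k eps x + (-1 * psireg k eps x) * (x 0 i * x 0 i)).
    by apply/funext => x; ring.
  apply: S0D; first by apply: S0M; [exact: S0_coord|exact: S0_qreg].
  by apply: S0M; apply: S0M; first [exact: S0_cst|exact: S0_psireg|exact: S0_coord].
have TL i : T0 (fun x => La i k v x ^+ 2) by apply: T0_sqr; exact: T0_X.
(* The defect between the limiting potential and the regularized one; [EEr] shows both of its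
   contributions with their sign. *)
pose Er x := (n%:R - 1) * v x ^+ 2 - \sum_(i | i != k) G i x.
have TGs : T0 (fun x => \sum_(i | i != k) G i x).
  under eq_fun do rewrite -big_filter; exact: T0_sum.
have TEr : T0 Er by apply: T0_sub => //; exact: T0Z.
have sumG : mu (fun x => \sum_(i | i != k) G i x) <= mu (Lsq v) / 2.
  rewrite ler_pdivlMr// mulrC.
  have -> : mu (fun x => \sum_(i | i != k) G i x) = \sum_(i | i != k) mu (G i).
    rewrite -[RHS]big_filter -(mu_sum _ TG).
    by apply: eq_mu => x; rewrite big_filter.
  apply: (@le_trans _ _ (2 * \sum_(i | i != k) mu (fun x => La i k v x ^+ 2))).
    by rewrite ler_pM2l//; apply: ler_sum => i ik; exact: mu_La_lower.
  have TLs : T0 (fun x => \sum_(i | i != k) La i k v x ^+ 2).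
    under eq_fun do rewrite -big_filter; exact: T0_sum.
  have -> : \sum_(i | i != k) mu (fun x => La i k v x ^+ 2) =
      mu (fun x => \sum_(i | i != k) La i k v x ^+ 2).
    rewrite -[LHS]big_filter -(mu_sum _ TL).
    by apply: eq_mu => x; rewrite big_filter.
  rewrite -(muZ _ TLs); apply: (mu_le (T0Z _ TLs) (T0_Lsq Tv)).
  by move=> x; exact: Lsq_ge.
have muEr : mu Er = (n%:R - 1) * mu (fun x => v x ^+ 2) - mu (fun x => \sum_(i | i != k) G i x).
  by rewrite (muB (T0Z _ Tv2) TGs) (muZ _ Tv2).
have EEr x : Er x = v x ^+ 2 * ((n%:R - 1) * (1 - x 0 k * qreg k eps x) +
    psireg k eps x * (nsq x - x 0 k ^+ 2)).
  rewrite /Er /G -mulr_sumr sumrB sumr_const -mulr_sumr sum_neq.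
  have -> : #|[pred i : 'I_n | i != k]| = n.-1.
    by have := cardC1 k; rewrite card_ord => <-; apply: eq_card.
  rewrite -[_ *+ n.-1]mulr_natl -subn1 natrB ?(leq_ltn_trans _ (ltn_ord k))//.
  by ring.
have bEr x : `|Er x| <= K * eps.
  have [ax|ax] := boolP (annulus A x); last first.
    by rewrite (proj2 TEr) ?normr0// mulr_ge0// ltW.
  have nx := annulus_nsq ax.
  have xk : x 0 k ^+ 2 <= nsq x by rewrite -subr_ge0 -sum_neq sumr_ge0// => i _; rewrite sqr_ge0.
  have xk1 : `|x 0 k| <= 1.
    by rewrite -(expr_le1 (n := 2))// real_normK ?num_real// (le_trans xk).
  have h1 := qreg_err k eps0 x; have h2 := psireg_ge0 k eps0 x.
  have h3 := qreg_err_le eps0 eps1 xk1; have h4 := psireg_le k eps0 x.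
  have v2 : v x ^+ 2 <= C ^+ 2 * x 0 k ^+ 2.
    rewrite -exprMn -[leLHS]real_normK ?num_real// -[leRHS]real_normK ?num_real//.
    rewrite ler_pXn2r ?nnegrE// normrM (le_trans (vC x))// ler_wpM2r//.
    exact: ler_norm.
  have p0 : 0 <= (n%:R - 1) * (1 - x 0 k * qreg k eps x) +
      psireg k eps x * (nsq x - x 0 k ^+ 2).
    by rewrite addr_ge0// mulr_ge0// subr_ge0.
  rewrite EEr ger0_norm; last by rewrite mulr_ge0// sqr_ge0.
  apply: (le_trans (ler_wpM2r p0 v2)); rewrite /K -[leLHS]mulrA -[C ^+ 2 * _ * eps]mulrA.
  apply: ler_wpM2l; first exact: sqr_ge0.
  rewrite mulrDr [leRHS]mulrDl mul1r; apply: lerD.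
    by rewrite mulrCA -[leRHS]mulrA; apply: ler_wpM2l.
  rewrite mulrA; apply: le_trans h4.
  apply: ler_piMr; first by rewrite mulr_ge0// sqr_ge0.
  by rewrite lerBlDr (le_trans nx)// lerDl sqr_ge0.
have := HW _ _ TEr (mulr_ge0 K0 (ltW eps0)) bEr; rewrite muEr => bound.
have b2 := le_trans (ler_norm _) bound.
have b3 : K * eps * W <= e * (K * W).
  by rewrite mulrAC [leRHS]mulrC ler_wpM2l// mulr_ge0.
move: b2 b3 sumG; rewrite -/(Lsq v).
move: (mu _) (mu _) (mu _) (K * eps * W) (K * W) => a b c d e' *; lra.
Qed.

End GroundState.

(** * Reflections in the coordinate hyperplanes *)

Section Parity.
Variables (R : realType) (n : nat) (A : radii R).
Local Notation V := 'rV[R]_n.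
Local Notation e_ := (@ebasis R n).
Local Notation T0 := (@T0 R n A).
Local Notation T1 := (@T1 R n A).
Local Notation T2 := (@T2 R n A).
Local Notation mu := (@mu R n).
Implicit Types (f g p v w : V -> R) (x y : V) (i j k l : 'I_n).

Definition refl k : V -> V := coordmap k -%R.
Definition sgn k i : R := if i == k then -1 else 1.

Lemma reflE k x i : refl k x 0 i = sgn k i * x 0 i.
Proof.
rewrite /refl /coordmap mxE /sgn -val_eqE/=.
by case: eqP => [/val_inj ->|_]; rewrite ?mulN1r ?mul1r.
Qed.

Lemma sgn2 k i : sgn k i * sgn k i = 1.
Proof. by rewrite /sgn; case: eqP; rewrite ?mulrNN mulr1. Qed.

Lemma norm_sgn k i : `|sgn k i| = 1.
Proof. by rewrite /sgn; case: eqP; rewrite ?normrN normr1. Qed.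

Lemma reflK k : involutive (refl k).
Proof. by move=> x; apply/rowP => i; rewrite !reflE mulrA sgn2 mul1r. Qed.

Lemma reflC k l x : refl k (refl l x) = refl l (refl k x).
Proof. by apply/rowP => i; rewrite !reflE mulrCA. Qed.

Lemma enorm_refl k x : enorm (refl k x) = enorm x.
Proof.
congr Num.sqrt; apply: eq_bigr => i _.
by rewrite reflE exprMn expr2 sgn2 mul1r.
Qed.

Lemma annulus_refl k x : annulus A (refl k x) = annulus A x.
Proof. by rewrite /annulus enorm_refl. Qed.

Lemma unifc_continuous f : unifc f -> continuous f.
Proof.
move=> uf x; apply/(@cvgrPdist_le _ _ _ (nbhs x)) => e e0; have [d d0 H] := uf e e0.
by apply/nbhs_ballP; exists d => // y [_ xy]; apply: H => i; exact: xy.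
Qed.

Lemma T0_refl k f : T0 f -> T0 (f \o refl k).
Proof.
move=> Tf; split=> [|x ax]; last by rewrite /= (proj2 Tf)// annulus_refl.
apply: unifc_continuous => e e0; have [d d0 H] := T0_unifc Tf e0.
exists d => // x y xy; apply: H => i.
by rewrite !reflE -mulrBr normrM norm_sgn mul1r.
Qed.

Lemma refl_line k i x (t : R) : refl k (t *: e_ i + x) = (sgn k i * t) *: e_ i + refl k x.
Proof.
apply/rowP => j; rewrite reflE.
have -> : ((sgn k i * t) *: e_ i + refl k x) 0 j = sgn k i * t * e_ i 0 j + sgn k j * x 0 j.
  by rewrite mxE reflE [in X in X + _]mxE.
rewrite !mxE eqxx/= mulrDr; congr (_ + _).
by case: eqP => [->|]; rewrite ?mulr0// !mulr1.
Qed.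

Lemma T1_refl k f : T1 f -> T1 (f \o refl k) /\
  forall i, partial i (f \o refl k) = (fun x => sgn k i * partial i f (refl k x)).
Proof.
move=> Tf; apply: T1I.
- exact: T0_refl (T1_T0 Tf).
- by move=> i; apply: T0Z; exact: (T0_refl k (T1_dT0 i Tf)).
- move=> i x; apply: line_is_derive.
  have -> : (fun s : R => (f \o refl k) (s *: e_ i + x)) =
      (fun s : R => f (s *: e_ i + refl k x)) \o (fun s => sgn k i * s).
    by apply/funext => s /=; rewrite refl_line.
  rewrite mulrC; apply: is_derive1_comp.
    by apply: is_derive_line; rewrite mulr0 scale0r add0r; exact: T1_is_derive Tf.
  have h := @is_deriveZ R R R id (sgn k i) (0 : R) (1 : R) _ (is_derive_id _ _).
  by apply: is_derive_eq h _; rewrite [_ *: 1]mulr1.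
Qed.

Lemma T2_refl k f : T2 f -> T2 (f \o refl k).
Proof.
move=> [Tf Tdf]; have [T E] := T1_refl k Tf; split; [exact: T|move=> i; rewrite E].
exact: (proj1 (T1Z _ (proj1 (T1_refl k (Tdf i))))).
Qed.

Lemma T2D f g : T2 f -> T2 g -> T2 (fun x => f x + g x).
Proof.
move=> [Tf Tdf] [Tg Tdg]; have [T E] := T1D Tf Tg; split; [exact: T|move=> i; rewrite E].
exact: (proj1 (T1D (Tdf i) (Tdg i))).
Qed.

Lemma T2Z f (c : R) : T2 f -> T2 (fun x => c * f x).
Proof.
move=> [Tf Tdf]; have [T E] := T1Z c Tf; split; [exact: T|move=> i; rewrite E].
exact: (proj1 (T1Z c (Tdf i))).
Qed.

Lemma La_refl k i j f x : T1 f ->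
  La i j (f \o refl k) x = sgn k i * sgn k j * La i j f (refl k x).
Proof.
move=> Tf; rewrite !LaE !(proj2 (T1_refl k Tf)) !reflE.
have si := sgn2 k i; have sj := sgn2 k j.
move: (sgn k i) (sgn k j) si sj => s t si sj.
move: (x 0 i) (x 0 j) (partial i f _) (partial j f _) => a b c d.
transitivity ((s * s) * (a * (t * d)) - (t * t) * (b * (s * c))); last by ring.
by rewrite si sj !mul1r.
Qed.

Lemma Lsq_refl k f x : T1 f -> Lsq (f \o refl k) x = Lsq f (refl k x).
Proof.
move=> Tf; apply: eq_bigr => i _; apply: eq_bigr => j _.
by rewrite La_refl// !exprMn !expr2 !sgn2 !mul1r.
Qed.

Lemma Lam_refl k f x : T2 f -> Lam (f \o refl k) x = Lam f (refl k x).
Proof.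
move=> Tf; apply: eq_bigr => i _; apply: eq_bigr => j _.
have [Tf1 _] := Tf; have TL := T1_La i j Tf.
have -> : La i j (f \o refl k) = (fun x => sgn k i * sgn k j * (La i j f \o refl k) x).
  by apply/funext => y; rewrite La_refl.
rewrite /La (X_scale _ _ _ (proj1 (T1_refl k TL))) -/(La i j _) La_refl//.
by rewrite mulrA mulrACA !sgn2 !mul1r.
Qed.

Lemma mu_refl k f : T0 f -> mu (f \o refl k) = mu f.
Proof.
move=> Tf; have [u s] := T0_UB (T0_wt Tf).
rewrite !muE -[RHS](@iter_integral_coordmap _ _ 1 _ k -%R ler01 u s).
  by apply: eq_int => x /=; rewrite -/(refl k x) /wt enorm_refl.
by move=> g cg g0; exact: Rintegral_reflect cg g0.
Qed.

Lemma La_lin i j f g (a b : R) x : T1 f -> T1 g ->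
  La i j (fun y => a * f y + b * g y) x = a * La i j f x + b * La i j g x.
Proof.
move=> Tf Tg; rewrite /La (X_add _ _ (proj1 (T1Z a Tf)) (proj1 (T1Z b Tg))).
by rewrite (X_scale _ _ _ Tf) (X_scale _ _ _ Tg).
Qed.

#[local] Opaque La.

Lemma Lam_lin f g (a b : R) x : T2 f -> T2 g ->
  Lam (fun y => a * f y + b * g y) x = a * Lam f x + b * Lam g x.
Proof.
move=> Tf Tg; rewrite /Lam !mulr_sumr -big_split; apply: eq_bigr => i _ /=.
rewrite !mulr_sumr -big_split; apply: eq_bigr => j _ /=.
have [Tf1 _] := Tf; have [Tg1 _] := Tg.
have -> : La i j (fun y => a * f y + b * g y) = (fun y => a * La i j f y + b * La i j g y).
  by apply/funext => y; rewrite La_lin.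
exact: La_lin (T1_La i j Tf) (T1_La i j Tg).
Qed.

(** The even part of [w] in [x_k] for [c = 2^-1], the odd part for [c = - 2^-1]. *)
Definition symp (c : R) k w x := 2^-1 * w x + c * w (refl k x).

Lemma T2_symp c k w : T2 w -> T2 (symp c k w).
Proof. by move=> Tw; exact: (T2D (T2Z _ Tw) (T2Z c (T2_refl k Tw))). Qed.

Lemma Lam_symp c k w x : T2 w ->
  Lam (symp c k w) x = 2^-1 * Lam w x + c * Lam (w \o refl k) x.
Proof. by move=> Tw; exact: Lam_lin Tw (T2_refl k Tw). Qed.

Lemma La_symp c k i j w x : T2 w ->
  La i j (symp c k w) x = 2^-1 * La i j w x + c * La i j (w \o refl k) x.
Proof. by move=> Tw; exact: La_lin (proj1 Tw) (proj1 (T2_refl k Tw)). Qed.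

Lemma half_parallelogram (a b : R) :
  (2^-1 * a + 2^-1 * b) ^+ 2 + (2^-1 * a + - 2^-1 * b) ^+ 2 = 2^-1 * a ^+ 2 + 2^-1 * b ^+ 2.
Proof. by field. Qed.

Lemma Lsq_symp k w x : T2 w -> Lsq (symp 2^-1 k w) x + Lsq (symp (- 2^-1) k w) x =
  2^-1 * Lsq w x + 2^-1 * Lsq (w \o refl k) x.
Proof.
move=> Tw; rewrite /Lsq !mulr_sumr -!big_split/=; apply: eq_bigr => i _.
rewrite !mulr_sumr -!big_split/=; apply: eq_bigr => j _.
rewrite (La_symp 2^-1 k i j x Tw) (La_symp (- 2^-1) k i j x Tw).
exact: half_parallelogram.
Qed.

Lemma mu_lin2 f g p v (a b : R) : T0 f -> T0 g -> T0 p -> T0 v ->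
  (forall x, p x + v x = a * f x + b * g x) -> mu p + mu v = a * mu f + b * mu g.
Proof.
move=> Tf Tg Tp Tv E; rewrite -(muZ _ Tf) -(muZ _ Tg) -(muD Tp Tv).
by rewrite -(muD (T0Z _ Tf) (T0Z _ Tg)); exact: eq_mu.
Qed.

End Parity.

#[local] Opaque Lam Lsq mu.

(** * The spectral gap of the spherical Laplacian *)

Section AngularGap.
Variables (R : realType) (n : nat) (A : radii R).
Local Notation V := 'rV[R]_n.
Local Notation e_ := (@ebasis R n).
Local Notation T0 := (@T0 R n A).
Local Notation T1 := (@T1 R n A).
Local Notation T2 := (@T2 R n A).
Local Notation mu := (@mu R n).
Implicit Types (f g p v w : V -> R) (x y : V) (i j k l : 'I_n).

(** Four times [mu (Lambda w)^2 - (n - 1) mu |L w|^2], as [Lam] and [Lsq] count each pair twice. *)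
Definition angular_gap w : R := mu (fun x => Lam w x ^+ 2) - 2 * (n%:R - 1) * mu (Lsq w).

Lemma angular_gap_refl k w : T2 w -> angular_gap (w \o refl k) = angular_gap w.
Proof.
move=> Tw; have [Tw1 _] := Tw.
have E1 : mu (fun x => Lam (w \o refl k) x ^+ 2) = mu (fun x => Lam w x ^+ 2).
  apply: etrans (mu_refl k (T0_sqr (T0_Lam Tw))).
  by apply: eq_mu => x; rewrite (Lam_refl k x Tw).
have E2 : mu (Lsq (w \o refl k)) = mu (Lsq w).
  apply: etrans (mu_refl k (T0_Lsq Tw1)).
  by apply: eq_mu => x; rewrite (Lsq_refl k x Tw1).
exact: (congr2 (fun a b => a - 2 * (n%:R - 1) * b) E1 E2).
Qed.

(** A quadratic form invariant under a reflection has no cross term between even and odd parts: the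
    parallelogram law gives the mean of the values at [w] and at its reflection, which agree. *)
Lemma angular_gap_split k w : T2 w -> angular_gap w = angular_gap (symp 2^-1 k w) + angular_gap (symp (- 2^-1) k w).
Proof.
move=> Tw; have Tr := T2_refl k Tw; have [Tw1 _] := Tw; have [Tr1 _] := Tr.
have Te := T2_symp 2^-1 k Tw; have To := T2_symp (- 2^-1) k Tw.
have E1 : mu (fun x => Lam (symp 2^-1 k w) x ^+ 2) +
    mu (fun x => Lam (symp (- 2^-1) k w) x ^+ 2) =
    2^-1 * mu (fun x => Lam w x ^+ 2) + 2^-1 * mu (fun x => Lam (w \o refl k) x ^+ 2).
  apply: (mu_lin2 (T0_sqr (T0_Lam Tw)) (T0_sqr (T0_Lam Tr))
    (T0_sqr (T0_Lam Te)) (T0_sqr (T0_Lam To))) => x.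
  rewrite (Lam_symp 2^-1 k x Tw) (Lam_symp (- 2^-1) k x Tw).
  exact: half_parallelogram.
have E2 : mu (Lsq (symp 2^-1 k w)) + mu (Lsq (symp (- 2^-1) k w)) =
    2^-1 * mu (Lsq w) + 2^-1 * mu (Lsq (w \o refl k)).
  apply: (mu_lin2 (T0_Lsq Tw1) (T0_Lsq Tr1) (T0_Lsq (proj1 Te)) (T0_Lsq (proj1 To))) => x.
  exact: (Lsq_symp k x Tw).
have lin_solve (c s t s' t' a b p q : R) : a + b = 2^-1 * s + 2^-1 * s' ->
    p + q = 2^-1 * t + 2^-1 * t' -> s' - c * t' = s - c * t ->
    s - c * t = (a - c * p) + (b - c * q).
  move=> h1 h2 h3; have -> : a - c * p + (b - c * q) = (a + b) - c * (p + q) by ring.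
  rewrite h1 h2; have -> : 2^-1 * s + 2^-1 * s' - c * (2^-1 * t + 2^-1 * t') =
    2^-1 * (s - c * t) + 2^-1 * (s' - c * t') by ring.
  by rewrite h3; field.
exact: lin_solve E1 E2 (angular_gap_refl k Tw).
Qed.

(** The mean value theorem between [x] and its projection on the hyperplane [x_k = 0], where oddness
    forces [v] to vanish. *)
Lemma odd_bound v k : T1 v -> (forall x, v (refl k x) = - v x) ->
  exists C, forall x, `|v x| <= C * `|x 0 k|.
Proof.
move=> Tv vodd; have [C C0 HC] := T0_bounded (T1_dT0 k Tv); exists C => x.
have [c _ Ec] := @MVT_line _ _ v (e_ k) x (- x 0 k) 
  (fun y => @ex_derive _ _ _ _ _ _ _ (T1_is_derive k y Tv)).
rewrite -/(partial k v _) in Ec.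
have x'0 : v (- x 0 k *: e_ k + x) = 0.
  have := vodd (- x 0 k *: e_ k + x); rewrite (_ : refl _ _ = - x 0 k *: e_ k + x).
    by move=> h; lra.
  apply/rowP => i; rewrite reflE !mxE eqxx/= /sgn; case: eqP => [->|_].
    by rewrite mulr1 addNr mulr0.
  by rewrite mul1r.
move: Ec; rewrite x'0 sub0r mulNr => /oppr_inj ->.
by rewrite normrM mulrC ler_wpM2r//; exact: HC.
Qed.

(** Cauchy-Schwarz in the form [0 <= mu (Lam w + N w)^2] with [N = 2 (n - 1)]: the cross term is
    [- 2 N mu (Lsq w)] by Green's formula, and [N ^ 2 mu w^2 <= N mu (Lsq w)] by [ground_state]. *)
Lemma angular_gap_odd k w : T2 w -> (forall x, w (refl k x) = - w x) -> 0 <= angular_gap w.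
Proof.
move=> Tw wodd; have [Tw1 _] := Tw; have [C HC] := odd_bound Tw1 wodd.
have GS := ground_state Tw1 HC; have GR := mu_Lam_green Tw.
have TL := T0_Lam Tw; have T0w := T1_T0 Tw1.
have n1 : 0 <= n%:R - 1 :> R by rewrite subr_ge0 ler1n (leq_ltn_trans _ (ltn_ord k)).
set N := 2 * (n%:R - 1) in GS; have N0 : 0 <= N by rewrite mulr_ge0.
have Tl : T0 (fun x => 2 * N * (w x * Lam w x) + N ^+ 2 * w x ^+ 2).
  by apply: T0D; apply: T0Z; [exact: T0_mul|exact: T0_sqr].
have E : mu (fun x => (Lam w x + N * w x) ^+ 2) =
    mu (fun x => Lam w x ^+ 2) + (2 * N * mu (fun x => w x * Lam w x) + N ^+ 2 * mu (fun x => w x ^+ 2)).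
  rewrite -(muZ _ (T0_mul T0w TL)) -(muZ _ (T0_sqr T0w)).
  rewrite -(muD (T0Z _ (T0_mul T0w TL)) (T0Z _ (T0_sqr T0w))) -(muD (T0_sqr TL) Tl).
  by apply: eq_mu => x; move: (Lam w x) (w x) => a b; ring.
have P : 0 <= mu (fun x => (Lam w x + N * w x) ^+ 2).
  by apply: mu_ge0 => x; exact: sqr_ge0.
rewrite E GR in P; rewrite /angular_gap -/N.
have := ler_wpM2l N0 GS; move: P.
move: (mu (fun x => Lam w x ^+ 2)) (mu (Lsq w)) (mu (fun x => w x ^+ 2)) => a b c.
move=> P H; have : N ^+ 2 * c = N * (N * c) by ring.
by move=> E'; rewrite E' in P; move: P H; move: (N * (N * c)) => d; nra.
Qed.

(** Evenness makes [partial i w] odd in [x_i], so [La i j w = x_i d_j w - x_j d_i w] vanishes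
    linearly on [x_i = 0]. [ground_state] applies to each [La i j w], and [mu_Lam_sqr] adds up the
    results. *)
Lemma angular_gap_even w : T2 w -> (forall k x, w (refl k x) = w x) -> 0 <= angular_gap w.
Proof.
move=> Tw weven; have [Tw1 Tdw] := Tw.
have dodd i x : partial i w (refl i x) = - partial i w x.
  have := proj2 (T1_refl i Tw1) i.
  rewrite (_ : w \o refl i = w); last by apply/funext => y; exact: weven.
  by move=> /(congr1 (fun F => F x)) ->; rewrite /sgn eqxx mulN1r opprK.
have GS i j : 2 * (n%:R - 1) * mu (fun x => La i j w x ^+ 2) <= mu (Lsq (La i j w)).
  (* [C] controls [d_i w] by [|x_i|] and [C'] bounds [d_j w]. Since [odd_bound] says nothing on the
     sign of [C], its absolute value enters the final constant. *)
  have [C HC] := odd_bound (Tdw i) (dodd i).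
  have [C' C'0 HC'] := T0_bounded (T1_dT0 j Tw1).
  have TL := T1_La i j Tw.
  apply: (@ground_state _ _ A _ i (C' + `|C|) TL) => x.
  have [ax|ax] := boolP (annulus A x); last first.
    by rewrite (proj2 (T1_T0 TL)) ?normr0// mulr_ge0// addr_ge0// ltW.
  have xj : `|x 0 j| <= 1.
    by apply: le_trans (coord_le_enorm x j) _; have /andP[_ /ltW] := annulusW ax.
  rewrite LaE (le_trans (ler_normB _ _))// !normrM mulrDl; apply: lerD.
    by rewrite mulrC ler_wpM2r//; exact: HC'.
  rewrite -[leRHS]mul1r; apply: ler_pM => //.
  by apply: le_trans (HC x) _; rewrite ler_wpM2r// ler_norm.
rewrite /angular_gap subr_ge0 (mu_Lsq Tw1) (mu_Lam_sqr Tw) mulr_sumr.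
apply: ler_sum => i _; rewrite mulr_sumr; apply: ler_sum => j _; exact: GS.
Qed.

(** Induction on the number [d] of coordinates in which evenness is not yet known. Splitting along
    the first of them gives an odd part, already settled, and a part even in one more coordinate. *)
Lemma angular_gap_ge0 w : T2 w -> 0 <= angular_gap w.
Proof.
move=> Tw.
have aux d : (d <= n)%N -> forall w, T2 w ->
    (forall k x, (k < n - d)%N -> w (refl k x) = w x) -> 0 <= angular_gap w.
  elim: d => [_|d IH dn] {Tw}w Tw weven.
    by apply: angular_gap_even => // k x; apply: weven; rewrite subn0.
  have kn : (n - d.+1 < n)%N by rewrite ltn_subrL (leq_ltn_trans _ dn).
  pose k := Ordinal kn; rewrite (angular_gap_split k Tw) addr_ge0//.
    apply: (IH (ltnW dn)); first exact: T2_symp.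
    move=> l x ld; rewrite /symp; have [lk|] := eqVneq l k.
      by rewrite lk reflK addrC.
    move=> lk; have {}ld : (l < n - d.+1)%N.
      rewrite ltn_neqAle; apply/andP; split; first exact: lk.
      by rewrite -ltnS -subSn.
    by rewrite (reflC k l) (weven l x ld) (weven l (refl k x) ld).
  apply: (@angular_gap_odd k); first exact: T2_symp.
  by move=> x; rewrite /symp reflK; move: (w x) (w (refl k x)) => a b; ring.
by apply: (aux n) => // k x; rewrite subnn.
Qed.

End AngularGap.

#[local] Transparent La Lam Lsq mu.

(** * Hardy inequalities in the radial variable *)

Section Radial.
Variables (R : realType) (n : nat) (A : radii R).
Local Notation V := 'rV[R]_n.
Local Notation e_ := (@ebasis R n).
Local Notation T0 := (@T0 R n A).
Local Notation T1 := (@T1 R n A).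
Local Notation T2 := (@T2 R n A).
Local Notation mu := (@mu R n).
Local Notation Eul := (@Eul R n).
Implicit Types (f g p v w u : V -> R) (x y : V) (i j k l : 'I_n).

Lemma T0_Eul f : T1 f -> T0 (Eul f). Proof. exact: T0_X. Qed.

Lemma T1_Eul f : T2 f -> T1 (Eul f).
Proof. by move=> Tf; have [] := T1_X 1%:M Tf. Qed.

Lemma mu_Eul f : T1 f -> mu (Eul f) = 0.
Proof. by move=> Tf; apply: (mu_X Tf); exact: mu_invariant1. Qed.

Lemma mu_Eul_ibp f g : T1 f -> T1 g ->
  mu (fun x => f x * Eul g x) = - mu (fun x => Eul f x * g x).
Proof. by move=> Tf Tg; apply: (mu_ibp Tf Tg); exact: mu_invariant1. Qed.

Lemma mu_Eul_self f : T1 f -> mu (fun x => Eul f x * f x) = 0.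
Proof.
move=> Tf; have h := mu_Eul_ibp Tf Tf.
have E : mu (fun x => f x * Eul f x) = mu (fun x => Eul f x * f x).
  by apply: eq_mu => x; rewrite mulrC.
rewrite E in h; move: h; move: (mu _) => a h; lra.
Qed.

Lemma Eul_La i j w : T2 w -> Eul (La i j w) = La i j (Eul w).
Proof.
move=> Tw; apply/funext => x; have := X_comm 1%:M (rotmx R i j) x Tw.
by rewrite mul1mx mulmx1 => /addIr.
Qed.

(** The Euler field commutes with rotations, so [mu_X_swap] exchanges the outer [Eul] and the outer
    [La i j] without forming third derivatives. *)
Lemma mu_La_Eul i j w : T2 w ->
  mu (fun x => Eul (Eul w) x * La i j (La i j w) x) =
  mu (fun x => La i j (Eul w) x ^+ 2).
Proof.
move=> Tw.
have := mu_X_swap (T1_Eul Tw) (T1_La i j Tw) (@mu_invariant1 R n) (@mu_invariant_rotmx R n i j).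
rewrite mul1mx mulmx1 => /addIr S; apply: etrans S _.
apply: eq_mu => x; exact: (congr1 (fun F => La i j (Eul w) x * F x) (Eul_La i j Tw)).
Qed.

Lemma Eul_lin f g (c : R) x : T1 f -> T1 g ->
  Eul (fun y => f y + c * g y) x = Eul f x + c * Eul g x.
Proof.
move=> Tf Tg; apply: etrans (X_add 1%:M x Tf (proj1 (T1Z c Tg))) _.
by congr (_ + _); exact: X_scale Tg.
Qed.

Lemma Eul_mul f g dg x : T1 f -> S1 g dg ->
  Eul (fun y => f y * g y) x = Eul f x * g x + f x * \sum_i x 0 i * dg i x.
Proof.
move=> Tf Sg; apply: etrans (X_mul 1%:M x Tf Sg) _; congr (_ + _ * _).
by apply: eq_bigr => i _; rewrite /lin mulmx1.
Qed.

Definition tau x : R := (ln (enorm x))^-1.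

Definition dtau i x : R :=
  - (ln (enorm x)) ^- 2 * ((enorm x)^-1 * (x 0 i / enorm x)).

Lemma S1_tau : S1 tau dtau.
Proof.
apply: (S1_inv (@S1_ln R n)) => x /andP[x0 x1].
by rewrite lt_eqF// ln_lt0// x0 x1.
Qed.

(** Since [E (ln |x|) = 1], the inverse logarithm satisfies [E tau = - tau ^ 2], the identity behind
    both Hardy inequalities. *)
Lemma sum_dtau x : Om x -> \sum_i x 0 i * dtau i x = - tau x ^+ 2.
Proof.
move=> /andP[x0 _]; rewrite /dtau /tau exprVn.
transitivity (\sum_i - (ln (enorm x)) ^- 2 / enorm x ^+ 2 * x 0 i ^+ 2).
  apply: eq_bigr => i _; move: (ln _ ^- 2) (x 0 i) => c a.
  by field; rewrite gt_eqF.
rewrite -mulr_sumr -/(nsq x) -enorm_sqr mulfVK//.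
by rewrite expf_neq0// gt_eqF.
Qed.

(** Expanding [(E f - a f tau)^2] modulo the total derivative [E (f^2 tau)] gives the constant
    [a - a^2], largest at [a = 1/2]. *)
Lemma hardy f : T1 f -> 4^-1 * mu (fun x => (f x * tau x) ^+ 2) <= mu (fun x => Eul f x ^+ 2).
Proof.
move=> Tf; have [TF _] := T1_mul Tf Tf; have [TG _] := T1M TF S1_tau.
have Z := mu_Eul TG; have St : S0 tau by have [] := S1_tau.
have t1 : T0 (fun x => (Eul f x - 2^-1 * (f x * tau x)) ^+ 2).
  by apply: T0_sqr; apply: T0_sub; [exact: T0_Eul|apply: T0Z; apply: T0M => //; exact: T1_T0].
have t2 : T0 (fun x => (f x * tau x) ^+ 2).
  by apply: T0_sqr; apply: T0M => //; exact: T1_T0.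
have t3 := T0_Eul TG.
have E x : Eul f x ^+ 2 = (Eul f x - 2^-1 * (f x * tau x)) ^+ 2 +
    (2^-1 * Eul (fun y => f y * f y * tau y) x + 4^-1 * (f x * tau x) ^+ 2).
  rewrite (Eul_mul x TF S1_tau) (Eul_mul x Tf (T1_S1 Tf)) -EulE.
  have [ax|ax] := boolP (annulus A x).
    by rewrite (sum_dtau (annulusW ax)); move: (Eul f x) (f x) (tau x) => a b c; field.
  rewrite (proj2 (T1_T0 Tf))// (proj2 (T0_Eul Tf))//; move: (\sum_i _) => s; ring.
rewrite [leRHS](eq_mu E) (muD t1 (T0D (T0Z _ t3) (T0Z _ t2))) (muD (T0Z _ t3) (T0Z _ t2)).
rewrite (muZ _ t3) (muZ _ t2) Z mulr0 add0r lerDr.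
by apply: mu_ge0 => x; exact: sqr_ge0.
Qed.

(** The same argument with [E (f^2 tau^3)], where [E (tau^3) = - 3 tau^4]: the constant is
    [3 a - a^2], largest at [a = 3/2]. *)
Lemma hardy_weighted f : T1 f -> 9 / 4 * mu (fun x => (f x * tau x ^+ 2) ^+ 2) <=
  mu (fun x => (Eul f x * tau x) ^+ 2).
Proof.
move=> Tf; have [TF _] := T1_mul Tf Tf.
have St : S0 tau by have [] := S1_tau.
have S3 := S1M (S1M S1_tau S1_tau) S1_tau.
have [TG _] := T1M TF S3; have Z := mu_Eul TG.
have Ttau g : T0 g -> T0 (fun x => g x * tau x) by move=> Tg; exact: T0M.
have t1 : T0 (fun x => ((Eul f x - 3 / 2 * (f x * tau x)) * tau x) ^+ 2).
  apply: T0_sqr; apply: (Ttau _); apply: T0_sub; first exact: T0_Eul.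
  by apply: T0Z; apply: (Ttau _); exact: T1_T0.
have t2 : T0 (fun x => (f x * tau x ^+ 2) ^+ 2).
  apply: T0_sqr; have := Ttau _ (Ttau _ (T1_T0 Tf)).
  by under eq_fun do rewrite -mulrA.
have t3 := T0_Eul TG.
have E x : (Eul f x * tau x) ^+ 2 = ((Eul f x - 3 / 2 * (f x * tau x)) * tau x) ^+ 2 +
    (3 / 2 * Eul (fun y => f y * f y * (tau y * tau y * tau y)) x +
     9 / 4 * (f x * tau x ^+ 2) ^+ 2).
  rewrite (Eul_mul x TF S3) (Eul_mul x Tf (T1_S1 Tf)) -EulE.
  have -> : \sum_i x 0 i * ((dtau i x * tau x + tau x * dtau i x) * tau x +
      tau x * tau x * dtau i x) = 3 * tau x ^+ 2 * \sum_i x 0 i * dtau i x.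
    by rewrite mulr_sumr; apply: eq_bigr => i _; ring.
  have [ax|ax] := boolP (annulus A x).
    by rewrite (sum_dtau (annulusW ax)); move: (Eul f x) (f x) (tau x) => a b c; field.
  rewrite (proj2 (T1_T0 Tf))// (proj2 (T0_Eul Tf))//; move: (\sum_i _) => s; ring.
rewrite [leRHS](eq_mu E) (muD t1 (T0D (T0Z _ t3) (T0Z _ t2))) (muD (T0Z _ t3) (T0Z _ t2)).
rewrite (muZ _ t3) (muZ _ t2) Z mulr0 add0r lerDr.
by apply: mu_ge0 => x; exact: sqr_ge0.
Qed.

End Radial.

(** * The quadratic form in [w] and its lower bound *)

Section Core.
Variables (R : realType) (n : nat) (A : radii R).
Local Notation V := 'rV[R]_n.
Local Notation T0 := (@T0 R n A).
Local Notation T1 := (@T1 R n A).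
Local Notation T2 := (@T2 R n A).
Local Notation mu := (@mu R n).
Local Notation Eul := (@Eul R n).
Implicit Types (f g p v w u : V -> R) (x y : V) (i j k l : 'I_n).

Lemma mu_bil f g p (c : R) : T0 f -> T0 g -> T0 p ->
  mu (fun x => (f x + c * g x) * p x) = mu (fun x => f x * p x) + c * mu (fun x => g x * p x).
Proof.
move=> Tf Tg Tp; have t1 := T0_mul Tf Tp; have t2 := T0_mul Tg Tp.
rewrite -(muZ _ t2) -(muD t1 (T0Z _ t2)).
by apply: eq_mu => x; move: (f x) (g x) (p x) => a b d; ring.
Qed.

Lemma mu_sq f g (c : R) : T0 f -> T0 g ->
  mu (fun x => (f x + c * g x) ^+ 2) =
  mu (fun x => f x ^+ 2) + (2 * c * mu (fun x => f x * g x) + c ^+ 2 * mu (fun x => g x ^+ 2)).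
Proof.
move=> Tf Tg; have t1 := T0_mul Tf Tg; have t2 := T0_sqr Tg; have t3 := T0_sqr Tf.
rewrite -(muZ _ t1) -(muZ _ t2) -(muD (T0Z _ t1) (T0Z _ t2)).
rewrite -(muD t3 (T0D (T0Z _ t1) (T0Z _ t2))).
by apply: eq_mu => x; move: (f x) (g x) => a b; ring.
Qed.

Lemma mu_Lam_mul f w : T0 f -> T2 w ->
  mu (fun x => f x * Lam w x) = \sum_i \sum_j mu (fun x => f x * La i j (La i j w) x).
Proof.
move=> Tf Tw; rewrite -(mu_sum2 (A := A)); last first.
  by move=> i j; exact: (T0_mul Tf (T0_La i j (T1_La i j Tw))).
apply: eq_mu => x; rewrite /Lam mulr_sumr; apply: eq_bigr => i _; exact: mulr_sumr.
Qed.

Lemma mu_EE_Lam w : T2 w -> 0 <= mu (fun x => Eul (Eul w) x * Lam w x).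
Proof.
move=> Tw; rewrite (mu_Lam_mul (T0_Eul (T1_Eul Tw)) Tw).
apply: sumr_ge0 => i _; apply: sumr_ge0 => j _.
by rewrite (mu_La_Eul i j Tw); apply: mu_ge0 => x; exact: sqr_ge0.
Qed.

(** After one integration by parts, each term is the integral of [E] applied to half the square of
    [La i j w]. *)
Lemma mu_E_Lam w : T2 w -> mu (fun x => Eul w x * Lam w x) = 0.
Proof.
move=> Tw; rewrite (mu_Lam_mul (T0_Eul (proj1 Tw)) Tw).
rewrite big1// => i _; rewrite big1// => j _.
have h := mu_ibp (T1_Eul Tw) (T1_La i j Tw) (@mu_invariant_rotmx R n i j).
apply: etrans h _; apply/eqP; rewrite oppr_eq0; apply/eqP.
apply: etrans (mu_Eul_self (T1_La i j Tw)).
apply: eq_mu => x.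
exact: (congr1 (fun F => F x * La i j w x) (esym (Eul_La i j Tw))).
Qed.

Lemma core_inequality w (c d : R) : T2 w -> 0 <= n%:R - 1 + 2 * c * d - d ^+ 2 ->
  d ^+ 2 * mu (fun x => (Eul w x - c * w x) ^+ 2 + 2^-1 * Lsq w x)
  + c ^+ 2 / 4 * mu (fun x => (w x * tau x) ^+ 2)
  + 9 / 16 * mu (fun x => (w x * tau x ^+ 2) ^+ 2)
  <= mu (fun x => (Eul (Eul w) x + (d - c) * Eul w x - c * d * w x + 2^-1 * Lam w x) ^+ 2).
Proof.
move=> Tw cd; have [Tw1 _] := Tw.
have T0w := T1_T0 Tw1; have TE := T0_Eul Tw1; have TE1 := T1_Eul Tw.
have TEE := T0_Eul TE1; have TL := T0_Lam Tw; have TS := T0_Lsq Tw1.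
have i1 := mu_Eul_self TE1; have i2 := mu_Eul_ibp Tw1 TE1.
have i4 := mu_Eul_self Tw1; have i3 := mu_EE_Lam Tw; have i5 := mu_E_Lam Tw.
have i6 := mu_Lam_green Tw; have P := angular_gap_ge0 Tw.
have h1 := hardy Tw1; have h2 := hardy TE1; have h3 := hardy_weighted Tw1.
have Ta := T0D TEE (T0Z (d - c) TE); have Tb := T0D Ta (T0Z (- (c * d)) T0w).
have EF : mu (fun x => (Eul (Eul w) x + (d - c) * Eul w x - c * d * w x + 2^-1 * Lam w x) ^+ 2) =
  mu (fun x => (Eul (Eul w) x + (d - c) * Eul w x + - (c * d) * w x + 2^-1 * Lam w x) ^+ 2).
  by apply: eq_mu => x; rewrite mulNr.
have EG : mu (fun x => (Eul w x - c * w x) ^+ 2 + 2^-1 * Lsq w x) =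
    mu (fun x => (Eul w x + - c * w x) ^+ 2) + 2^-1 * mu (Lsq w).
  rewrite -(muZ _ TS) -(muD (T0_sqr (T0D TE (T0Z (- c) T0w))) (T0Z _ TS)).
  by apply: eq_mu => x; rewrite mulNr.
have c1 : mu (fun x => Eul (Eul w) x * w x) = - mu (fun x => Eul w x ^+ 2).
  by apply: etrans i2; apply: eq_mu => x; rewrite mulrC.
have c2 : mu (fun x => w x * Lam w x) = - mu (Lsq w) := i6.
have S0L : 0 <= mu (Lsq w).
  apply: mu_ge0 => x; apply: sumr_ge0 => i _; apply: sumr_ge0 => j _; exact: sqr_ge0.
have F1 := mu_sq 2^-1 Tb TL; have F2 := mu_sq (- (c * d)) Ta T0w.
have F3 := mu_sq (d - c) TEE TE; have F4 := mu_bil (- (c * d)) Ta T0w TL.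
have F5 := mu_bil (d - c) TEE TE TL; have F6 := mu_bil (d - c) TEE TE T0w.
have G1 := mu_sq (- c) TE T0w.
rewrite EF EG F1 F2 F3 F4 F5 F6 G1 i1 i4 i5 c1 c2; move: P h1 h2 h3 i3 S0L; rewrite /angular_gap.
move: (mu (fun x => Eul (Eul w) x * Lam w x)) (mu (fun x => Lam w x ^+ 2)) (mu (Lsq w)).
move: (mu (fun x => Eul (Eul w) x ^+ 2)) (mu (fun x => (Eul w x * tau x) ^+ 2)).
move: (mu (fun x => Eul w x ^+ 2)) (mu (fun x => (w x * tau x) ^+ 2)).
move: (mu (fun x => w x ^+ 2)) (mu (fun x => (w x * tau x ^+ 2) ^+ 2)).
move=> W W4 E W2 EE Et I S L P h1 h2 h3 i3 S0L.
(* The right side minus the gradient term is now [EE + c^2 E + S / 4 + I + (c d - d^2 / 2) L]. By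
   [P], [S / 4] is at least [(n - 1) L / 2], so the terms in [L] add up to at least half of the
   quantity in [H3]. *)
have H1 : c ^+ 2 / 4 * W2 <= c ^+ 2 * E.
  by rewrite -mulrA ler_wpM2l// sqr_ge0.
(* The Rellich constant is [1/4 * 9/4]: Hardy for [Eul w], then the weighted inequality for [w]. *)
have H2 : 9 / 16 * W4 <= EE by clear -h2 h3; lra.
have H3 : 0 <= (n%:R - 1 + 2 * c * d - d ^+ 2) * L by rewrite mulr_ge0.
clear -H1 H2 H3 P i3; move: (n%:R) H3 P => N H3 P.
nra.
Qed.

End Core.

(** * Back to the original function *)

Section Substitution.
Variables (R : realType) (n : nat) (A : radii R).
Local Notation V := 'rV[R]_n.
Local Notation e_ := (@ebasis R n).
Local Notation T0 := (@T0 R n A).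
Local Notation T1 := (@T1 R n A).
Local Notation T2 := (@T2 R n A).
Local Notation mu := (@mu R n).
Local Notation Eul := (@Eul R n).
Implicit Types (f g p v w u : V -> R) (x y : V) (i j k l : 'I_n).

Definition pw (c : R) x : R := enorm x `^ c.
Definition dpw (c : R) i x : R := c * enorm x `^ (c - 1) * (x 0 i / enorm x).

Lemma S1_pw c : S1 (pw c) (dpw c). Proof. exact: S1_powR. Qed.

Lemma T2_pw c f : T2 f -> T2 (fun x => f x * pw c x).
Proof.
move=> [Tf Tdf]; have [T E] := T1M Tf (S1_pw c); split; first exact: T.
move=> i; rewrite E.
have Si : S1 (fun x : V => (enorm x)^-1) (fun i x => - (enorm x) ^- 2 * (x 0 i / enorm x)).
  by apply: (S1_inv (@S1_enorm R n)) => x /andP[x0 _]; rewrite gt_eqF.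
have Sd := S1M (S1M (@S1_cst R n c) (@S1_powR R n (c - 1))) (S1M (@S1_coord R n i) Si).
exact: (proj1 (T1D (proj1 (T1M (Tdf i) (S1_pw c))) (proj1 (T1M Tf Sd)))).
Qed.

Lemma sum_dpw c x : Om x -> \sum_i x 0 i * dpw c i x = c * pw c x.
Proof.
move=> /andP[x0 _].
transitivity (\sum_i c * enorm x `^ (c - 1) / enorm x * x 0 i ^+ 2).
  by apply: eq_bigr => i _; rewrite /dpw; ring.
rewrite -mulr_sumr -/(nsq x) -enorm_sqr /pw powRB; last first.
  by apply/implyP => _; rewrite gt_eqF.
rewrite powRr1 ?ltW//; move: (enorm x `^ c) => a.
by field; rewrite gt_eqF.
Qed.

Lemma Eul_pw c f x : T1 f ->
  Eul (fun y => f y * pw c y) x = (Eul f x + c * f x) * pw c x.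
Proof.
move=> Tf; rewrite (Eul_mul x Tf (S1_pw c)); have [ax|ax] := boolP (annulus A x).
  by rewrite (sum_dpw c (annulusW ax)); move: (Eul f x) (f x) (pw c x) => a b d; ring.
rewrite (proj2 (T1_T0 Tf))// (proj2 (T0_Eul Tf))//; move: (\sum_i _) => s; ring.
Qed.

(** Rotation fields annihilate radial functions. *)
Lemma La_pw c i j f x : T1 f -> La i j (fun y => f y * pw c y) x = La i j f x * pw c x.
Proof.
move=> Tf; rewrite /La (X_mul _ _ Tf (S1_pw c)) sum_lin_rotmx.
rewrite (_ : x 0 i * dpw c j x - _ = 0) ?mulr0 ?addr0//.
by rewrite /dpw; move: (enorm x `^ _) ((enorm x)^-1) => a b; ring.
Qed.

Lemma EulEul_pw c f x : T2 f -> Eul (Eul (fun y => f y * pw c y)) x =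
  (Eul (Eul f) x + 2 * c * Eul f x + c ^+ 2 * f x) * pw c x.
Proof.
move=> Tf; have [Tf1 _] := Tf; have TE := T1_Eul Tf.
have [TEc _] := T1D TE (proj1 (T1Z c Tf1)).
have -> : Eul (fun y => f y * pw c y) = (fun y => (Eul f y + c * f y) * pw c y).
  by apply/funext => y; rewrite Eul_pw.
rewrite (Eul_pw c x TEc); congr (_ * _).
rewrite (Eul_lin c x TE Tf1).
by move: (Eul (Eul f) x) (Eul f x) (f x) => a b d; ring.
Qed.

Lemma Lsq_pw c f x : T1 f -> Lsq (fun y => f y * pw c y) x = Lsq f x * pw c x ^+ 2.
Proof.
move=> Tf; rewrite /Lsq mulr_suml; apply: eq_bigr => i _.
by rewrite mulr_suml; apply: eq_bigr => j _; rewrite (La_pw c i j x Tf) exprMn.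
Qed.

Lemma Lam_pw c f x : T2 f -> Lam (fun y => f y * pw c y) x = Lam f x * pw c x.
Proof.
move=> Tf; rewrite /Lam mulr_suml; apply: eq_bigr => i _.
rewrite mulr_suml; apply: eq_bigr => j _; have [Tf1 _] := Tf.
have -> : La i j (fun y => f y * pw c y) = (fun y => La i j f y * pw c y).
  by apply/funext => y; rewrite (La_pw c i j y Tf1).
exact: La_pw (T1_La i j Tf).
Qed.

(** Lagrange's identity for the vectors [x] and [grad f]. *)
Lemma Lsq_grad f x : 2^-1 * Lsq f x + Eul f x ^+ 2 = nsq x * grad_norm2 f x.
Proof.
pose a i : R := x 0 i; pose b i := partial i f x.
have -> : Lsq f x = \sum_k \sum_l (a k * b l - a l * b k) * (a k * b l - a l * b k).
  by apply: eq_bigr => k _; apply: eq_bigr => l _; rewrite LaE expr2.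
rewrite Binet_Cauchy.
have -> : Eul f x = dot a b by rewrite EulE.
have -> : dot a a = nsq x by apply: eq_bigr => i _; rewrite expr2.
have -> : dot b b = grad_norm2 f x by apply: eq_bigr => i _; rewrite expr2.
by rewrite [dot b a]dotC; field.
Qed.

Lemma partial_X B m f x : T2 f -> partial m (X B f) x =
  \sum_i B m i * partial i f x + \sum_i lin B i x * partial m (partial i f) x.
Proof. by move=> Tf; rewrite (proj2 (T1_X B Tf)) big_split. Qed.

Lemma partial_La i j m f x : T2 f -> partial m (La i j f) x =
  (m == i)%:R * partial j f x - (m == j)%:R * partial i f x +
  (x 0 i * partial m (partial j f) x - x 0 j * partial m (partial i f) x).
Proof.
move=> Tf; have H := partial_X (rotmx R i j) m x Tf; apply: etrans H _.
rewrite sum_lin_rotmx; congr (_ + _).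
under eq_bigr => k _ do rewrite !mxE mulrBl -!mulnb !natrM -!mulrA.
by rewrite big_split/= sumrN -!mulr_sumr !sum_delta.
Qed.

(** The double sum met in [laplacian_polar], with [a] standing for [x], [d] for the gradient and [h]
    for the Hessian. *)
Lemma sum_second_order (a d : 'I_n -> R) (h : 'I_n -> 'I_n -> R) :
  \sum_i \sum_j (a i * ((i == j)%:R * d j) - a i * d i +
    (a i ^+ 2 * h j j - a j * a i * h j i)) =
  \sum_i a i * d i - n%:R * (\sum_i a i * d i) +
  ((\sum_i a i ^+ 2) * (\sum_j h j j) - \sum_j \sum_i a j * a i * h j i).
Proof.
under eq_bigr => i _ do rewrite big_split/= sumrB sumrB.
rewrite big_split/= !sumrB; congr (_ - _ + (_ - _)).
- apply: eq_bigr => i _; rewrite -mulr_sumr; congr (_ * _).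
  by under eq_bigr => j _ do rewrite eq_sym; rewrite sum_delta.
- rewrite mulr_sumr; apply: eq_bigr => i _.
  by rewrite sumr_const card_ord mulr_natl.
- by rewrite mulr_suml; apply: eq_bigr => i _; rewrite -mulr_sumr.
- by rewrite exchange_big.
Qed.

Lemma laplacian_polar f x : T2 f ->
  nsq x * laplacian f x = Eul (Eul f) x + (n%:R - 2) * Eul f x + 2^-1 * Lam f x.
Proof.
move=> Tf.
pose M := \sum_j \sum_i x 0 j * x 0 i * partial j (partial i f) x.
have EE : Eul (Eul f) x = Eul f x + M.
  rewrite EulE; under eq_bigr => j _ do rewrite (partial_X 1%:M j x Tf) mulrDr.
  rewrite big_split/=; congr (_ + _).
    rewrite EulE; apply: eq_bigr => j _; congr (_ * _).
    by under eq_bigr => i _ do rewrite mxE eq_sym; rewrite sum_delta.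
  apply: eq_bigr => j _; rewrite mulr_sumr; apply: eq_bigr => i _.
  by rewrite /lin mulmx1 mulrA.
have LL i j : La i j (La i j f) x =
    x 0 i * ((i == j)%:R * partial j f x - partial i f x +
      x 0 i * partial j (partial j f) x - x 0 j * partial j (partial i f) x) -
    x 0 j * (partial j f x - (i == j)%:R * partial i f x +
      x 0 i * partial i (partial j f) x - x 0 j * partial i (partial i f) x).
  by rewrite LaE (partial_La _ _ _ _ Tf) (partial_La _ _ _ _ Tf) !eqxx [j == i]eq_sym !mul1r !addrA.
(* [La i j (La i j f)] is the symmetrization of [P], so [Lam f] is twice the double sum of [P]. *)
pose P i j := x 0 i * ((i == j)%:R * partial j f x) - x 0 i * partial i f x +
  (x 0 i ^+ 2 * partial j (partial j f) x - x 0 j * x 0 i * partial j (partial i f) x).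
have LP i j : La i j (La i j f) x = P i j + P j i.
  rewrite LL /P [j == i]eq_sym; move: ((i == j)%:R) (x 0 i) (x 0 j) => e a b.
  move: (partial i f x) (partial j f x) (partial j (partial j f) x) => fi fj fjj.
  move: (partial j (partial i f) x) (partial i (partial j f) x) (partial i (partial i f) x).
  by move=> fji fij fii; ring.
have sumP : \sum_i \sum_j P i j = Eul f x - n%:R * Eul f x + (nsq x * laplacian f x - M).
  by rewrite EulE; exact: (sum_second_order (fun i => x 0 i) (fun i => partial i f x)
    (fun j i => partial j (partial i f) x)).
have -> : Lam f x = 2 * (Eul f x - n%:R * Eul f x + (nsq x * laplacian f x - M)).
  rewrite -sumP mulr_natl mulr2n {2}exchange_big/= -big_split; apply: eq_bigr => i _.
  by rewrite -big_split; apply: eq_bigr => j _; rewrite LP.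
rewrite EE; move: (Eul f x) (nsq x * _) (M) => a b c.
by field.
Qed.

(** Turns the weights of the norms into that of [mu]. With [a = c], the exponent [m] is 4 for the
    Laplacian, 2 for the gradient and 0 for the logarithmic terms. *)
Lemma weight_split (a s : R) x (m : nat) : Om x -> s = m%:R + a *+ 2 - n%:R ->
  enorm x `^ s = enorm x ^+ m * pw a x ^+ 2 * wt x.
Proof.
move=> /andP[x0 _] ->; have xn : enorm x != 0 by rewrite gt_eqF.
rewrite powRD ?xn ?implybT// powRD ?xn ?implybT// powR_mulrn ?ltW// /pw /wt.
by rewrite mulr2n powRD ?xn ?implybT// expr2.
Qed.

Lemma rellich_T2 (alpha : R) u :
  `|3 * alpha + 4 + n%:R| <= 2 * Num.sqrt (n%:R ^+ 2 - n%:R + 1) -> T2 u ->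
  (n%:R + alpha) ^+ 2 / 4 * wnorm2_grad (alpha + 2) u
    + (n%:R - 4 - alpha) ^+ 2 / 16 * wnorm2 (alpha + 4) (fun x => (ln (enorm x))^-1 * u x)
    + 9 / 16 * wnorm2 (alpha + 4) (fun x => (ln (enorm x)) ^- 2 * u x)
  <= wnorm2 alpha (laplacian u).
Proof.
move=> hyp Tu; have [Tu1 Tdu] := Tu; have T0u := T1_T0 Tu1.
pose c := (n%:R - 4 - alpha) / 2; pose d := (n%:R + alpha) / 2.
pose w x := u x * pw c x; have Tw : T2 w by exact: T2_pw.
(* [4 (n^2 - n + 1) - (3 alpha + 4 + n)^2] is exactly 12 times this quantity. *)
have cd : 0 <= n%:R - 1 + 2 * c * d - d ^+ 2.
  have sq : (3 * alpha + 4 + n%:R) ^+ 2 <= 4 * (n%:R ^+ 2 - n%:R + 1).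
    have p0 : 0 <= n%:R ^+ 2 - n%:R + 1 :> R.
      by have := sqr_ge0 (n%:R - 1 / 2 : R); move: (n%:R : R) => N; nra.
    rewrite -[leLHS]real_normK ?num_real//.
    have -> : 4 * (n%:R ^+ 2 - n%:R + 1) = (2 * Num.sqrt (n%:R ^+ 2 - n%:R + 1)) ^+ 2 :> R.
      by rewrite exprMn sqr_sqrtr//; ring.
    by rewrite ler_pXn2r ?nnegrE// mulr_ge0// sqrtr_ge0.
  rewrite /c /d; move: sq; move: (n%:R : R) => N; nra.
have main := core_inequality Tw cd.
have e2 : c ^+ 2 / 4 = (n%:R - 4 - alpha) ^+ 2 / 16 by rewrite /c; field.
have e1 : d ^+ 2 = (n%:R + alpha) ^+ 2 / 4 by rewrite /d; field.
rewrite e1 e2 in main.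
have n0 x : ~~ annulus A x -> u x = 0 by exact: (proj2 T0u).
have lap0 x : ~~ annulus A x -> laplacian u x = 0.
  by move=> ax; rewrite /laplacian big1// => i _; exact: (proj2 (T1_dT0 i (Tdu i)) x ax).
have grad0 x : ~~ annulus A x -> grad_norm2 u x = 0.
  move=> ax; rewrite /grad_norm2 big1// => i _.
  by rewrite (proj2 (T1_dT0 i Tu1) x ax) expr0n.
have E1 : wnorm2_grad (alpha + 2) u = mu (fun x => (Eul w x - c * w x) ^+ 2 + 2^-1 * Lsq w x).
  apply: eq_int => x; rewrite (Eul_pw c x Tu1) (Lsq_pw c x Tu1) /w.
  have -> : ((Eul u x + c * u x) * pw c x - c * (u x * pw c x)) ^+ 2 +
      2^-1 * (Lsq u x * pw c x ^+ 2) = (2^-1 * Lsq u x + Eul u x ^+ 2) * pw c x ^+ 2.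
    by move: (Eul u x) (Lsq u x) (u x) (pw c x) => *; ring.
  rewrite Lsq_grad; have [ax|ax] := boolP (annulus A x); last first.
    by rewrite grad0// mulr0 !mul0r.
  rewrite (@weight_split c _ x 2 (annulusW ax)); last by rewrite /c; field.
  by rewrite enorm_sqr; move: (grad_norm2 u x) (nsq x) (pw c x) (wt x) => *; ring.
have E2 : wnorm2 (alpha + 4) (fun x => (ln (enorm x))^-1 * u x) = mu (fun x => (w x * tau x) ^+ 2).
  apply: eq_int => x; rewrite real_normK ?num_real// /w /tau.
  have [ax|ax] := boolP (annulus A x); last first.
    by rewrite n0// !(mulr0, mul0r) expr0n/= !mul0r.
  rewrite (@weight_split c _ x 0 (annulusW ax)); last by rewrite /c; field.
  by rewrite expr0; move: ((ln (enorm x))^-1) (u x) (pw c x) (wt x) => *; ring.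
have E3 : wnorm2 (alpha + 4) (fun x => (ln (enorm x)) ^- 2 * u x) =
    mu (fun x => (w x * tau x ^+ 2) ^+ 2).
  apply: eq_int => x; rewrite real_normK ?num_real// /w /tau -exprVn.
  have [ax|ax] := boolP (annulus A x); last first.
    by rewrite n0// !(mulr0, mul0r) expr0n/= !mul0r.
  rewrite (@weight_split c _ x 0 (annulusW ax)); last by rewrite /c; field.
  by rewrite expr0; move: ((ln (enorm x))^-1) (u x) (pw c x) (wt x) => *; ring.
have E4 : wnorm2 alpha (laplacian u) =
    mu (fun x => (Eul (Eul w) x + (d - c) * Eul w x - c * d * w x + 2^-1 * Lam w x) ^+ 2).
  apply: eq_int => x; rewrite real_normK ?num_real//.
  rewrite (EulEul_pw c x Tu) (Eul_pw c x Tu1) (Lam_pw c x Tu) /w.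
  (* The terms in [u] cancel, [c^2 + (d - c) c - c d = 0], and [Eul u] gets the coefficient
     [c + d = n - 2] of the Laplacian in polar form. *)
  have -> : (Eul (Eul u) x + 2 * c * Eul u x + c ^+ 2 * u x) * pw c x +
      (d - c) * ((Eul u x + c * u x) * pw c x) - c * d * (u x * pw c x) +
      2^-1 * (Lam u x * pw c x) = nsq x * laplacian u x * pw c x.
    rewrite (laplacian_polar x Tu) (_ : n%:R - 2 = c + d); last by rewrite /c /d; field.
    by move: (Eul (Eul u) x) (Eul u x) (Lam u x) (u x) (pw c x) => *; ring.
  have [ax|ax] := boolP (annulus A x); last first.
    by rewrite lap0// mulr0 mul0r expr0n/= !mul0r.
  rewrite (@weight_split c _ x 4 (annulusW ax)); last by rewrite /c; field.
  rewrite (_ : enorm x ^+ 4 = nsq x ^+ 2); last by rewrite -enorm_sqr -exprM.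
  by move: (laplacian u x) (nsq x) (pw c x) (wt x) => *; ring.
by rewrite E1 E2 E3 E4.
Qed.

End Substitution.

#[local] Transparent partial.

(** * From compact support in the punctured ball to an annulus *)

Section CompactSupport.
Variables (R : realType) (n : nat).
Local Notation V := 'rV[R]_n.
Local Notation e_ := (@ebasis R n).
Implicit Types (f u : V -> R) (x y : V) (i j k l : 'I_n).

Lemma enorm_gt0 x : x != 0 -> 0 < enorm x.
Proof.
move=> x0; rewrite lt0r enorm_ge0 andbT; apply: contra x0 => /eqP e0.
apply/eqP/rowP => i; rewrite mxE; apply/eqP.
by rewrite -normr_le0 -e0 coord_le_enorm.
Qed.

Lemma partial_off (K : set V) f i : closed K -> (forall x, ~ K x -> f x = 0) ->
  forall x, ~ K x -> partial i f x = 0.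
Proof.
move=> cK f0 x Kx; have oK : open (~` K) by exact: closed_openC.
have : \forall y \near x, f y = cst 0 y.
  by apply: filterS (open_nbhs_nbhs (conj oK Kx)) => y Ky; rewrite f0.
by move=> /(near_eq_derive (e_ i)) E; rewrite /partial E derive_cst.
Qed.

(** The radii are the minimum and the maximum of [enorm] on the compact support; the derivatives
    vanish off the support because it is closed. *)
Lemma Cc2_T2 u : Cc2_punctured_ball u -> exists A : radii R, T2 A u.
Proof.
move=> [[cu [du [cdu [ddu cddu]]]] [K_compact KO]].
have cK : closed (support_set u) by exact: closed_closure.
have u0 x : ~ support_set u x -> u x = 0.
  move=> Kx; apply/eqP; apply: contrapT => /negP ux; apply: Kx.
  exact: subset_closure.
have du0 i := partial_off i cK u0.
have ddu0 i j := partial_off j cK (du0 i).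
have [A HA] : exists A : radii R, forall x, support_set u x -> annulus A x.
  have [K0|/nonemptyPn K0] := pselect (support_set u !=set0); last first.
    (* The support is empty here, and any radii will do. *)
    have h1 : 0 < 2^-1 :> R by rewrite invr_gt0.
    have h2 : 2^-1 < 1 :> R by rewrite invf_lt1// ltr1n.
    by exists (Radii h1 h2) => x; rewrite K0.
  have ce := continuous_subspaceT (@continuous_enorm R n).
  have [a aK amin] := compact_EVT_min K0 K_compact (ce _).
  have [b bK bmax] := compact_EVT_max K0 K_compact (ce _).
  have a0 : 0 < enorm a by apply: enorm_gt0; have [] := KO a (set_mem aK).
  have b1 : enorm b < 1 by have [] := KO b (set_mem bK).
  exists (Radii a0 b1) => x Kx; apply/andP; split; [apply: amin|apply: bmax]; exact: mem_set.
have off x : ~~ annulus A x -> ~ support_set u x by move=> ax /HA; exact/negP.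
exists A; split; [split|move=> i; split] => //.
- by split=> // x /off; exact: u0.
- by move=> i; split=> // x /off; exact: du0.
- by split=> // x /off; exact: du0.
- by move=> j; split=> // x /off; exact: ddu0.
Qed.

End CompactSupport.

Theorem theorem1p5 (R : realType) (n : nat) (alpha : R) :
  (2 <= n)%N ->
  `|3 * alpha + 4 + n%:R| <= 2 * Num.sqrt (n%:R ^+ 2 - n%:R + 1) ->
  forall u : 'rV[R]_n -> R, Cc2_punctured_ball u ->
  wnorm2 alpha (laplacian u) >=
    (n%:R + alpha) ^+ 2 / 4 * wnorm2_grad (alpha + 2) u
    + (n%:R - 4 - alpha) ^+ 2 / 16 * wnorm2 (alpha + 4) (fun x => (ln (enorm x))^-1 * u x)
    + 9 / 16 * wnorm2 (alpha + 4) (fun x => (ln (enorm x)) ^- 2 * u x).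
Proof. by move=> _ hyp u /Cc2_T2[A Tu]; exact: rellich_T2 hyp Tu. Qed.
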